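(* Let $R$ be a commutative noetherian ring, let $C$ be a semidualizing $R$-module, and let $M$ and $N$ be $R$-modules. For each $i$, there is a natural isomorphism $$\operatorname{Tor}^{\mathcal{P}_C\mathcal{M}}_i(M,N)\cong\operatorname{Tor}^{\mathcal{F}_C\mathcal{M}}_i(M,N).$$
   Context: $R$ is a commutative noetherian ring. A finitely generated $R$-module $C$ is semidualizing if the homothety map $R\to\operatorname{Hom}_R(C,C)$ is an isomorphism and $\operatorname{Ext}^i_R(C,C)=0$ for all $i\geq 1$. $\mathcal{P}_C(R)$ is the class of $R$-modules isomorphic to $P\otimes_R C$ with $P$ projective, and $\mathcal{F}_C(R)$ is the class of $R$-modules isomorphic to $F\otimes_R C$ with $F$ flat. For a precovering class $\mathcal{X}$ of $R$-modules, a proper $\mathcal{X}$-resolution of $M$ is a complex $X=(\cdots\to X_1\to X_0\to 0)$ with each $X_i\in\mathcal{X}$ together with an augmentation $X_0\to M$ such that $X^+=(\cdots\to X_1\to X_0\to M\to 0)$ is a complex (not necessarily exact) and $\operatorname{Hom}_R(Y,X^+)$ is exact for all $Y\in\mathcal{X}$. Both $\mathcal{P}_C(R)$ and $\mathcal{F}_C(R)$ are precovering, so every module has proper resolutions of both kinds. If $Q$ is a proper $\mathcal{P}_C$-resolution of $M$ and $G$ is a proper $\mathcal{F}_C$-resolution of $M$, then for $i\geq 0$ $$\operatorname{Tor}^{\mathcal{P}_C\mathcal{M}}_i(M,N):=H_i(Q\otimes_R N),\qquad \operatorname{Tor}^{\mathcal{F}_C\mathcal{M}}_i(M,N):=H_i(G\otimes_R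 N).$$ These are independent of the choice of proper resolutions and functorial in both arguments. *)

(* Defs.v *)
From HB Require Import structures.
From mathcomp Require Import all_boot all_order all_algebra.
From mathcomp Require Import generic_quotient boolp.

Set Implicit Arguments.
Unset Strict Implicit.
Unset Printing Implicit Defensive.

Import GRing.Theory.
Local Open Scope ring_scope.
Local Open Scope quotient_scope.

(* Commutative rings are comPzRingType, so that the zero ring is allowed. *)

Section Generalities.
Variable R : comPzRingType.

Definition surj (A B : Type) (f : A -> B) := forall y, exists x, f x = y.

Definition isomorphic (U V : lmodType R) :=
  exists f : {linear U -> V}, bijective f.

Definition finitely_generated (M : lmodType R) :=
  exists n (g : 'I_n -> M), forall x, exists a : 'I_n -> R,
    x = \sum_(i < n) a i *: g i.

Definition mk_linear (U V : lmodType R) (f : U -> V) (Hf : linear f) :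
    {linear U -> V} :=
  HB.pack f (GRing.isLinear.Build R U V *:%R f Hf).

Lemma linear_eqP (U V : lmodType R) (f g : {linear U -> V}) :
  f =1 g -> f = g.
Proof.
case: f => f [[fa] [fb]] /=; case: g => g [[ga] [gb]] /= /funext e.
rewrite {f}e in fa fb *.
by rewrite (Prop_irrelevance fa ga) (Prop_irrelevance fb gb).
Qed.

End Generalities.

Definition noetherian (R : comPzRingType) :=
  forall I : R -> Prop,
    I 0 -> (forall a x y, I x -> I y -> I (a * x + y)) ->
    exists n (g : 'I_n -> R),
      forall x, I x <-> exists a : 'I_n -> R, x = \sum_(i < n) a i * g i.

Section Hom.
Variables (R : comPzRingType) (U V : lmodType R).

Definition hom : Type := {linear U -> V}.
Definition hom_fun (f : hom) : {linear U -> V} := f.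

HB.instance Definition _ := gen_eqMixin hom.
HB.instance Definition _ := gen_choiceMixin hom.

Let zero : hom := \0 : {linear U -> V}.
Let opp (f : hom) : hom := \- (hom_fun f) : {linear U -> V}.
Let add (f g : hom) : hom := hom_fun f \+ hom_fun g : {linear U -> V}.
Let scale (a : R) (f : hom) : hom := a \*: hom_fun f : {linear U -> V}.

Fact hom_addA : associative add.
Proof. by move=> f g h; apply: linear_eqP => x /=; rewrite addrA. Qed.
Fact hom_addC : commutative add.
Proof. by move=> f g; apply: linear_eqP => x /=; rewrite addrC. Qed.
Fact hom_add0 : left_id zero add.
Proof. by move=> f; apply: linear_eqP => x /=; rewrite add0r. Qed.
Fact hom_addN : left_inverse zero opp add.
Proof. by move=> f; apply: linear_eqP => x /=; rewrite addNr. Qed.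
HB.instance Definition _ :=
  GRing.isZmodule.Build hom hom_addA hom_addC hom_add0 hom_addN.

Fact hom_scaleA a b (f : hom) : scale a (scale b f) = scale (a * b) f.
Proof. by apply: linear_eqP => x /=; rewrite scalerA. Qed.
Fact hom_scale1 : left_id 1 scale.
Proof. by move=> f; apply: linear_eqP => x /=; rewrite scale1r. Qed.
Fact hom_scaleDr : right_distributive scale +%R.
Proof. by move=> a f g; apply: linear_eqP => x /=; rewrite scalerDr. Qed.
Fact hom_scaleDl (f : hom) :
  {morph scale^~ f : a b / a + b >-> a + b}.
Proof. by move=> a b; apply: linear_eqP => x /=; rewrite scalerDl. Qed.
HB.instance Definition _ := GRing.Zmodule_isLmodule.Build R hom
  hom_scaleA hom_scale1 hom_scaleDr hom_scaleDl.

End Hom.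

Section HomFunctor.
Variable R : comPzRingType.

Fact hom_post_linear (U V W : lmodType R) (g : {linear V -> W}) :
  linear (fun f : hom U V => (g \o hom_fun f : {linear U -> W}) : hom U W).
Proof. by move=> a f f'; apply: linear_eqP => x /=; rewrite linearP. Qed.
Definition hom_post (U V W : lmodType R) (g : {linear V -> W}) :
  {linear hom U V -> hom U W} := mk_linear (hom_post_linear (U := U) g).

Fact hom_pre_linear (U V W : lmodType R) (h : {linear U -> V}) :
  linear (fun f : hom V W => (hom_fun f \o h : {linear U -> W}) : hom U W).
Proof. by move=> a f f'; apply: linear_eqP => x. Qed.
Definition hom_pre (U V W : lmodType R) (h : {linear U -> V}) :
  {linear hom V W -> hom U W} := mk_linear (hom_pre_linear (W := W) h).

Fact homothety_linear (C : lmodType R) :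
  linear (fun r : R^o => (r \*: idfun : {linear C -> C}) : hom C C).
Proof.
by move=> a r s; apply: linear_eqP => x /=; rewrite scalerDl scalerA.
Qed.
Definition homothety (C : lmodType R) : {linear R^o -> hom C C} :=
  mk_linear (homothety_linear C).

End HomFunctor.

Section Kernel.
Variables (R : comPzRingType) (U V : lmodType R) (f : {linear U -> V}).

Definition in_ker : {pred U} := fun x => f x == 0.

Fact in_ker_closed : submod_closed in_ker.
Proof.
split=> [|a u v]; first by rewrite unfold_in /= linear0.
by rewrite !unfold_in /= linearP => /eqP-> /eqP->; rewrite scaler0 addr0.
Qed.
HB.instance Definition _ := GRing.isSubmodClosed.Build R U in_ker
  in_ker_closed.

Record ker : Type := Ker { ker_val : U; ker_valP : ker_val \in in_ker }.
HB.instance Definition _ := [isSub for ker_val].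
HB.instance Definition _ := [Choice of ker by <:].
HB.instance Definition _ := [SubChoice_isSubLmodule of ker by <:].

End Kernel.

Section Cokernel.
Variables (R : comPzRingType) (U V : lmodType R) (f : {linear U -> V}).

Definition coker_rel (x y : V) : bool := `[< exists u, f u = x - y >].

Fact coker_rel_equiv : equiv_class_of coker_rel.
Proof.
split=> [x|x y|y x z].
- by apply/asboolP; exists 0; rewrite linear0 subrr.
- by apply/asbool_equiv_eq; split=> -[u e]; exists (- u);
    rewrite linearN e opprB.
- move=> /asboolP[u e] /asboolP[v e']; apply/asboolP; exists (u + v).
  by rewrite linearD e e' addrA subrK.
Qed.
Canonical coker_equiv := EquivRelPack coker_rel_equiv.

Definition coker : Type := {eq_quot coker_rel}.
HB.instance Definition _ := EqQuotient.on coker.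
HB.instance Definition _ := Choice.on coker.

Fact coker_ind (P : coker -> Prop) :
  (forall x, P (\pi_coker x)) -> forall x, P x.
Proof. by move=> h x; rewrite -[x]reprK; apply: h. Qed.

Fact coker_piP (x y : V) :
  (\pi_coker x = \pi_coker y) <-> exists u, f u = x - y.
Proof.
split; first by move/eqquotP => /= /asboolP.
by move=> h; apply/eqquotP; apply/asboolP.
Qed.

Fact coker_repr_pi (x : V) : exists u, f u = repr (\pi_coker x) - x.
Proof. by apply/coker_piP; rewrite reprK. Qed.

Let zero : coker := \pi_coker 0.
Let opp (x : coker) : coker := \pi_coker (- repr x).
Let add (x y : coker) : coker := \pi_coker (repr x + repr y).
Let scale (a : R) (x : coker) : coker := \pi_coker (a *: repr x).

Let pi_opp (x : V) : opp (\pi_coker x) = \pi_coker (- x).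
Proof.
have [u e] := coker_repr_pi x; apply/coker_piP; exists (- u).
by rewrite linearN e opprB opprK addrC.
Qed.
Let pi_add (x y : V) : add (\pi_coker x) (\pi_coker y) = \pi_coker (x + y).
Proof.
have [u e] := coker_repr_pi x; have [v e'] := coker_repr_pi y.
apply/coker_piP; exists (u + v).
by rewrite linearD e e' opprD addrACA.
Qed.
Let pi_scale a (x : V) : scale a (\pi_coker x) = \pi_coker (a *: x).
Proof.
have [u e] := coker_repr_pi x; apply/coker_piP; exists (a *: u).
by rewrite linearZ /= e scalerBr.
Qed.

Fact coker_addA : associative add.
Proof.
by move=> x y z; elim/coker_ind: x => x; elim/coker_ind: y => y;
  elim/coker_ind: z => z; rewrite !pi_add addrA.
Qed.
Fact coker_addC : commutative add.
Proof.
by move=> x y; elim/coker_ind: x => x; elim/coker_ind: y => y;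
  rewrite !pi_add addrC.
Qed.
Fact coker_add0 : left_id zero add.
Proof. by move=> x; elim/coker_ind: x => x; rewrite pi_add add0r. Qed.
Fact coker_addN : left_inverse zero opp add.
Proof. by move=> x; elim/coker_ind: x => x; rewrite pi_opp pi_add addNr. Qed.
HB.instance Definition _ :=
  GRing.isZmodule.Build coker coker_addA coker_addC coker_add0 coker_addN.

Fact coker_scaleA a b (x : coker) : scale a (scale b x) = scale (a * b) x.
Proof. by elim/coker_ind: x => x; rewrite !pi_scale scalerA. Qed.
Fact coker_scale1 : left_id 1 scale.
Proof. by move=> x; elim/coker_ind: x => x; rewrite pi_scale scale1r. Qed.
Fact coker_scaleDr : right_distributive scale +%R.
Proof.
move=> a; move=> x y; elim/coker_ind: x => x; elim/coker_ind: y => y.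
by rewrite [X in scale _ X]pi_add !pi_scale [RHS]pi_add scalerDr.
Qed.
Fact coker_scaleDl (x : coker) : {morph scale^~ x : a b / a + b >-> a + b}.
Proof.
elim/coker_ind: x => x a b.
by rewrite !pi_scale [RHS]pi_add scalerDl.
Qed.
HB.instance Definition _ := GRing.Zmodule_isLmodule.Build R coker
  coker_scaleA coker_scale1 coker_scaleDr coker_scaleDl.

Fact coker_proj_linear : linear (fun x : V => \pi_coker x).
Proof. move=> a x y.
by rewrite -[RHS]/(add (scale a (\pi_coker x)) (\pi_coker y)) pi_scale pi_add.
Qed.
Definition coker_proj : {linear V -> coker} := mk_linear coker_proj_linear.

Lemma coker_projP (x : V) : coker_proj x = 0 <-> exists u, f u = x.
Proof.
by rewrite -(linear0 coker_proj) /=; split=> [/coker_piP|h];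
  [|apply/coker_piP]; rewrite subr0.
Qed.

Lemma coker_proj_surj : surj coker_proj.
Proof. by move=> x; elim/coker_ind: x => x; exists x. Qed.

Section Lift.
Variables (W : lmodType R) (h : {linear V -> W}).
Hypothesis hf : forall u, h (f u) = 0.

Let lift (x : coker) : W := h (repr x).

Let lift_pi x : lift (\pi_coker x) = h x.
Proof.
have [u e] := coker_repr_pi x; apply/eqP.
by rewrite -subr_eq0 -linearB -e hf.
Qed.

Fact coker_lift_linear : linear lift.
Proof.
move=> a; move=> x y; elim/coker_ind: x => x; elim/coker_ind: y => y.
rewrite -[_ *: _ + _]/(a *: coker_proj x + coker_proj y) -linearP /=.
by rewrite !lift_pi linearP.
Qed.
Definition coker_lift : {linear coker -> W} := mk_linear coker_lift_linear.

Lemma coker_liftE x : coker_lift (coker_proj x) = h x.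
Proof. exact: lift_pi. Qed.
End Lift.

End Cokernel.

Section Tensor.
Variables (R : comPzRingType) (A B : lmodType R).

(* A (x) B by generators and relations: a list of pairs stands for the sum of
   the corresponding pure tensors, and tens_eq is the least congruence making
   the pure tensors bilinear.  The universal property is tens_lift, tens_liftE
   and tens_ext below. *)
Inductive tens_eq : seq (A * B) -> seq (A * B) -> Prop :=
| tens_refl s : tens_eq s s
| tens_sym s t : tens_eq s t -> tens_eq t s
| tens_trans s t u : tens_eq s t -> tens_eq t u -> tens_eq s u
| tens_cat s s' t t' :
    tens_eq s s' -> tens_eq t t' -> tens_eq (s ++ t) (s' ++ t')
| tens_catC s t : tens_eq (s ++ t) (t ++ s)
| tens_0l b : tens_eq [:: (0, b)] [::]
| tens_Dl a a' b : tens_eq [:: (a + a', b)] [:: (a, b); (a', b)]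
| tens_Dr a b b' : tens_eq [:: (a, b + b')] [:: (a, b); (a, b')]
| tens_ZZ r a b : tens_eq [:: (r *: a, b)] [:: (a, r *: b)].

Definition tens_rel s t : bool := `[< tens_eq s t >].

Fact tens_rel_equiv : equiv_class_of tens_rel.
Proof.
split=> [x|x y|y x z]; first exact/asboolP/tens_refl.
  by apply/asbool_equiv_eq; split; apply: tens_sym.
by move=> /asboolP h /asboolP k; apply/asboolP; apply: tens_trans h k.
Qed.
Canonical tens_equiv := EquivRelPack tens_rel_equiv.

Definition tensor : Type := {eq_quot tens_rel}.
HB.instance Definition _ := EqQuotient.on tensor.
HB.instance Definition _ := Choice.on tensor.

Fact tensor_ind (P : tensor -> Prop) :
  (forall x, P (\pi_tensor x)) -> forall x, P x.
Proof. by move=> h x; rewrite -[x]reprK; apply: h. Qed.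

Fact tens_piP s t : (\pi_tensor s = \pi_tensor t) <-> tens_eq s t.
Proof.
split; first by move/eqquotP => /= /asboolP.
by move=> h; apply/eqquotP; apply/asboolP.
Qed.

Fact tens_repr_pi s : tens_eq (repr (\pi_tensor s)) s.
Proof. by apply/tens_piP; rewrite reprK. Qed.

Let smul (r : R) (s : seq (A * B)) := [seq (r *: p.1, p.2) | p <- s].

Let smul_eq r s t : tens_eq s t -> tens_eq (smul r s) (smul r t).
Proof.
elim=> {s t} /=.
- by move=> s; apply: tens_refl.
- by move=> s t _; apply: tens_sym.
- by move=> s t u _ h _; apply: tens_trans.
- by move=> s s' t t' _ h _ k; rewrite /smul !map_cat; apply: tens_cat.
- by move=> s t; rewrite /smul !map_cat; apply: tens_catC.
- by move=> b; rewrite scaler0; apply: tens_0l.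
- by move=> a a' b; rewrite scalerDr; apply: tens_Dl.
- by move=> a b b'; apply: tens_Dr.
- by move=> q a b; rewrite scalerA mulrC -scalerA; apply: tens_ZZ.
Qed.

Let smulD r q s : tens_eq (smul (r + q) s) (smul r s ++ smul q s).
Proof.
elim: s => [|[a b] s IHs] /=; first exact: tens_refl.
rewrite -cat1s -[in X in tens_eq _ X]cat1s.
apply: tens_trans
  (_ : tens_eq _ ([:: (r *: a, b); (q *: a, b)] ++ (smul r s ++ smul q s))) _.
  by apply: tens_cat => //; rewrite scalerDl; apply: tens_Dl.
rewrite /= -cat1s -[X in tens_eq _ X]cat1s.
apply: tens_cat; first exact: tens_refl.
rewrite -cat1s -[_ :: smul q s]cat1s !catA.
by apply: tens_cat; [apply: tens_catC | apply: tens_refl].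
Qed.

Let smul0 s : tens_eq (smul 0 s) [::].
Proof.
elim: s => [|[a b] s IHs] /=; first exact: tens_refl.
by rewrite -cat1s -[X in tens_eq _ X]cats0; apply: tens_cat => //;
  rewrite scale0r; apply: tens_0l.
Qed.

Let smul1 s : smul 1 s = s.
Proof. by elim: s => [|[a b] s /= ->] //=; rewrite scale1r. Qed.

Let zero : tensor := \pi_tensor [::].
Let opp (x : tensor) : tensor := \pi_tensor (smul (- 1) (repr x)).
Let add (x y : tensor) : tensor := \pi_tensor (repr x ++ repr y).
Let scale (r : R) (x : tensor) : tensor := \pi_tensor (smul r (repr x)).

Let pi_add s t : add (\pi_tensor s) (\pi_tensor t) = \pi_tensor (s ++ t).
Proof. by apply/tens_piP; apply: tens_cat; apply: tens_repr_pi. Qed.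
Let pi_scale r s : scale r (\pi_tensor s) = \pi_tensor (smul r s).
Proof. by apply/tens_piP; apply: smul_eq; apply: tens_repr_pi. Qed.

Fact tens_addA : associative add.
Proof.
by move=> x y z; elim/tensor_ind: x => x; elim/tensor_ind: y => y;
  elim/tensor_ind: z => z; rewrite !pi_add catA.
Qed.
Fact tens_addC : commutative add.
Proof.
move=> x y; elim/tensor_ind: x => x; elim/tensor_ind: y => y; rewrite !pi_add.
by apply/tens_piP; apply: tens_catC.
Qed.
Fact tens_add0 : left_id zero add.
Proof. by move=> x; elim/tensor_ind: x => x; rewrite pi_add. Qed.
Fact tens_addN : left_inverse zero opp add.
Proof.
move=> x; elim/tensor_ind: x => s; rewrite -[opp _]/(scale _ _) pi_scale pi_add.
apply/tens_piP; rewrite -[in X in _ ++ X](smul1 s).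
by apply: tens_trans (tens_sym (smulD _ _ _)) _; rewrite addNr; apply: smul0.
Qed.
HB.instance Definition _ :=
  GRing.isZmodule.Build tensor tens_addA tens_addC tens_add0 tens_addN.

Fact tens_scaleA r q (x : tensor) : scale r (scale q x) = scale (r * q) x.
Proof.
elim/tensor_ind: x => s; rewrite !pi_scale /smul -map_comp.
congr (\pi_tensor _).
by apply: eq_map => -[a b] /=; rewrite scalerA.
Qed.
Fact tens_scale1 : left_id 1 scale.
Proof. by move=> x; elim/tensor_ind: x => s; rewrite pi_scale smul1. Qed.
Fact tens_scaleDr : right_distributive scale +%R.
Proof.
move=> r; move=> x y; elim/tensor_ind: x => s; elim/tensor_ind: y => t.
by rewrite [X in scale _ X]pi_add !pi_scale [RHS]pi_add /smul map_cat.
Qed.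
Fact tens_scaleDl (x : tensor) : {morph scale^~ x : a b / a + b >-> a + b}.
Proof.
elim/tensor_ind: x => s a b; rewrite !pi_scale [RHS]pi_add.
by apply/tens_piP; apply: smulD.
Qed.
HB.instance Definition _ := GRing.Zmodule_isLmodule.Build R tensor
  tens_scaleA tens_scale1 tens_scaleDr tens_scaleDl.

Definition pure (a : A) (b : B) : tensor := \pi_tensor [:: (a, b)].

Lemma pure_linear_l b : linear (pure^~ b).
Proof.
move=> r a a'.
rewrite -[RHS]/(add (scale r (pure a b)) (pure a' b)) pi_scale pi_add.
by apply/tens_piP; apply: tens_Dl.
Qed.

Lemma pure_linear_r a : linear (pure a).
Proof.
move=> r b b'.
rewrite -[RHS]/(add (scale r (pure a b)) (pure a b')) pi_scale pi_add.
apply/tens_piP; apply: tens_trans (tens_Dr _ _ _) _.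
rewrite -cat1s -[X in tens_eq _ X]cat1s.
by apply: tens_cat; [apply/tens_sym/tens_ZZ | apply: tens_refl].
Qed.

Lemma pure0l b : pure 0 b = 0.
Proof. exact: (linear0 (mk_linear (pure_linear_l b))). Qed.

Fact tensor_piE s : \pi_tensor s = \sum_(p <- s) pure p.1 p.2.
Proof.
elim: s => [|[a b] s IHs]; first by rewrite big_nil.
by rewrite big_cons -IHs [RHS]pi_add.
Qed.

Lemma tens_ext (W : lmodType R) (f g : {linear tensor -> W}) :
  (forall a b, f (pure a b) = g (pure a b)) -> f =1 g.
Proof.
move=> fg; move=> x; elim/tensor_ind: x => s; rewrite tensor_piE !linear_sum.
by apply: eq_bigr => -[a b] _; apply: fg.
Qed.

Section Lift.
Variables (W : lmodType R) (h : A -> B -> W).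
Hypotheses (hl : forall b, linear (h^~ b)) (hr : forall a, linear (h a)).

Let ev (s : seq (A * B)) : W := \sum_(p <- s) h p.1 p.2.

Let ev_eq s t : tens_eq s t -> ev s = ev t.
Proof.
have h0 b : h 0 b = 0 by exact: (linear0 (mk_linear (hl b))).
have hD a a' b : h (a + a') b = h a b + h a' b.
  by have /= := linearD (mk_linear (hl b)) a a'.
have hDr a b b' : h a (b + b') = h a b + h a b'.
  by have /= := linearD (mk_linear (hr a)) b b'.
have hZ r a b : h (r *: a) b = r *: h a b.
  by rewrite -[r *: a]addr0 hl h0 addr0.
have hZr r a b : h a (r *: b) = r *: h a b.
  have h0r : h a 0 = 0 by exact: (linear0 (mk_linear (hr a))).
  by rewrite -[r *: b]addr0 hr h0r addr0.
rewrite /ev; elim=> {s t} //=.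
- by move=> s t u _ -> _ ->.
- by move=> s s' t t' _ e _ e'; rewrite !big_cat /= e e'.
- by move=> s t; rewrite !big_cat /= addrC.
- by move=> b; rewrite big_seq1 big_nil.
- by move=> a a' b; rewrite !big_cons !big_nil !addr0 /= hD.
- by move=> a b b'; rewrite !big_cons !big_nil !addr0 /= hDr.
- by move=> r a b; rewrite !big_seq1 /= hZ hZr.
Qed.

Let lift (x : tensor) : W := ev (repr x).
Let lift_pi s : lift (\pi_tensor s) = ev s.
Proof. exact/ev_eq/tens_repr_pi. Qed.

Fact tens_lift_linear : linear lift.
Proof.
move=> r; move=> x y; elim/tensor_ind: x => s; elim/tensor_ind: y => t.
rewrite -[X in lift X]/(add (scale r (\pi_tensor s)) (\pi_tensor t)).
rewrite pi_scale pi_add !lift_pi /ev big_cat /=.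
rewrite /smul big_map scaler_sumr; congr (_ + _); apply: eq_bigr => p _ /=.
have h0 : h 0 p.2 = 0 by exact: (linear0 (mk_linear (hl p.2))).
by rewrite -[_ *: p.1]addr0 hl h0 addr0.
Qed.
Definition tens_lift : {linear tensor -> W} := mk_linear tens_lift_linear.

Lemma tens_liftE a b : tens_lift (pure a b) = h a b.
Proof. by rewrite /= lift_pi /ev big_seq1. Qed.
End Lift.

End Tensor.

Section TensorMap.
Variables (R : comPzRingType) (A A' B B' : lmodType R).
Variables (f : {linear A -> A'}) (g : {linear B -> B'}).

Let h a b := pure (f a) (g b).
Let hl b : linear (h^~ b).
Proof. by move=> r a a'; rewrite /h linearP pure_linear_l. Qed.
Let hr a : linear (h a).
Proof. by move=> r b b'; rewrite /h linearP pure_linear_r. Qed.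

Definition tens_map : {linear tensor A B -> tensor A' B'} := tens_lift hl hr.

Lemma tens_mapE a b : tens_map (pure a b) = pure (f a) (g b).
Proof. exact: tens_liftE. Qed.

End TensorMap.

Lemma tens_map_comp (R : comPzRingType) (A A' A'' B B' B'' : lmodType R)
    (f' : {linear A' -> A''}) (f : {linear A -> A'})
    (g' : {linear B' -> B''}) (g : {linear B -> B'}) x :
  tens_map f' g' (tens_map f g x) =
  tens_map (f' \o f : {linear A -> A''}) (g' \o g : {linear B -> B''}) x.
Proof.
rewrite -[LHS]/((tens_map f' g' \o tens_map f g) x).
apply: tens_ext => a b.
by rewrite [LHS](congr1 _ (tens_mapE _ _ a b)) !tens_mapE.
Qed.

Lemma eq_tens_map (R : comPzRingType) (A A' B B' : lmodType R)
    (f f' : {linear A -> A'}) (g g' : {linear B -> B'}) :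
  f =1 f' -> g =1 g' -> tens_map f g =1 tens_map f' g'.
Proof. by move=> ef eg; apply: tens_ext => a b; rewrite !tens_mapE ef eg. Qed.

Section HomologyAt.
Variables (R : comPzRingType) (U V W : lmodType R).
Variables (f : {linear U -> V}) (g : {linear V -> W}).
Hypothesis gf : forall x, g (f x) = 0.

Fact corestr_subproof x : f x \in in_ker g.
Proof. by apply/eqP; apply: gf. Qed.
Fact corestr_linear : linear (fun x => Ker (corestr_subproof x)).
Proof.
move=> a x y; apply: val_inj; apply: etrans (linearP f a x y) _.
by rewrite linearP.
Qed.
Definition corestr : {linear U -> ker g} := mk_linear corestr_linear.

Definition homology_at : lmodType R := coker corestr.

End HomologyAt.

Section Complexes.
Variable R : comPzRingType.

Record chain_complex := ChainComplex {
  obj :> nat -> lmodType R;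
  diff : forall n, {linear obj n.+1 -> obj n};
  diffK : forall n x, diff n (diff n.+1 x) = 0 }.

(* The differential leaving degree n; in degree 0 it is zero, with the dummy
   target X 0. *)
Definition diff_out (X : chain_complex) n : {linear X n -> X n.-1} :=
  match n return {linear X n -> X n.-1} with
  | 0 => \0
  | m.+1 => diff X m
  end.

Fact diff_outK (X : chain_complex) n x : diff_out X n (diff X n x) = 0.
Proof. by case: n x => [|n] x //=; rewrite diffK. Qed.

Definition homology (X : chain_complex) n : lmodType R :=
  homology_at (diff_outK (X := X) (n := n)).

(* Exactness in every degree, including surjectivity of X 1 -> X 0. *)
Definition exact_complex (X : chain_complex) :=
  forall n (x : X n), diff_out X n x = 0 -> exists y, diff X n y = x.

Record cochain_complex := CochainComplex {
  cobj :> nat -> lmodType R;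
  codiff : forall n, {linear cobj n -> cobj n.+1};
  codiffK : forall n x, codiff n.+1 (codiff n x) = 0 }.

Definition codiff_in (X : cochain_complex) n : {linear X n.-1 -> X n} :=
  match n return {linear X n.-1 -> X n} with
  | 0 => \0
  | m.+1 => codiff X m
  end.

Fact codiff_inK (X : cochain_complex) n x : codiff X n (codiff_in X n x) = 0.
Proof. by case: n x => [|n] x /=; rewrite ?linear0 ?codiffK. Qed.

Definition cohomology (X : cochain_complex) n : lmodType R :=
  homology_at (codiff_inK (X := X) (n := n)).

Record chain_map (X Y : chain_complex) := ChainMap {
  cmap :> forall n, {linear X n -> Y n};
  cmap_diff : forall n x, cmap n (diff X n x) = diff Y n (cmap n.+1 x) }.

Section HomologyMap.
Variables (X Y : chain_complex) (u : chain_map X Y) (n : nat).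

Fact cmap_ker_subproof (x : ker (diff_out X n)) :
  u n (val x) \in in_ker (diff_out Y n).
Proof.
case: x => x /= /eqP; rewrite unfold_in; case: n x => [|m] x //= e.
by rewrite -cmap_diff e linear0.
Qed.
Fact cmap_ker_linear : linear (fun x => Ker (cmap_ker_subproof x)).
Proof.
move=> a x y; apply: val_inj; apply: etrans (_ : u n (val (a *: x + y)) = _) _.
  by [].
by rewrite [val _]linearP (linearP (u n)) [RHS]linearP.
Qed.
Definition cmap_ker : {linear ker (diff_out X n) -> ker (diff_out Y n)} :=
  mk_linear cmap_ker_linear.

Let hY := coker_proj (corestr (diff_outK (X := Y) (n := n))).
Fact homology_map_subproof x :
  (hY \o cmap_ker) (corestr (diff_outK (X := X) (n := n)) x) = 0.
Proof.
apply/coker_projP; exists (u n.+1 x).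
by apply: val_inj; rewrite /= cmap_diff.
Qed.
Definition homology_map : {linear homology X n -> homology Y n} :=
  coker_lift homology_map_subproof.

End HomologyMap.

Fact tens_diffK (X : chain_complex) (N : lmodType R) n x :
  tens_map (diff X n) (idfun : {linear N -> N})
    (tens_map (diff X n.+1) (idfun : {linear N -> N}) x) = 0.
Proof.
rewrite -[LHS]/((tens_map _ _ \o tens_map _ _) x) -[RHS]/(\0 x).
apply: tens_ext => a b.
by rewrite [LHS](congr1 _ (tens_mapE _ _ a b)) tens_mapE diffK; apply: pure0l.
Qed.
Definition tens_complex (X : chain_complex) (N : lmodType R) : chain_complex :=
  {| obj n := tensor (X n) N; diff n := tens_map (diff X n) idfun;
     diffK := @tens_diffK X N |}.

Fact tens_chain_map_subproof (X Y : chain_complex) (N N' : lmodType R)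
  (u : chain_map X Y) (g : {linear N -> N'}) n x :
  tens_map (u n) g (diff (tens_complex X N) n x) =
  diff (tens_complex Y N') n (tens_map (u n.+1) g x).
Proof.
apply: etrans (tens_map_comp _ _ _ _ _) _.
apply: etrans (esym (tens_map_comp _ _ _ _ _)).
by apply: eq_tens_map => // a; apply: cmap_diff.
Qed.
Definition tens_chain_map (X Y : chain_complex) (N N' : lmodType R)
    (u : chain_map X Y) (g : {linear N -> N'}) :
    chain_map (tens_complex X N) (tens_complex Y N') :=
  @ChainMap (tens_complex X N) (tens_complex Y N')
    (fun n => tens_map (u n) g) (tens_chain_map_subproof u g).

Fact hom_from_diffK (Y : lmodType R) (X : chain_complex) n f :
  hom_post Y (diff X n) (hom_post Y (diff X n.+1) f) = 0.
Proof. by apply: linear_eqP => y /=; rewrite diffK. Qed.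
Definition hom_from (Y : lmodType R) (X : chain_complex) : chain_complex :=
  {| obj n := hom Y (X n); diff n := hom_post Y (diff X n);
     diffK := @hom_from_diffK Y X |}.

Fact hom_to_codiffK (X : chain_complex) (N : lmodType R) n f :
  hom_pre N (diff X n.+1) (hom_pre N (diff X n) f) = 0.
Proof. by apply: linear_eqP => x /=; rewrite diffK linear0. Qed.
Definition hom_to (X : chain_complex) (N : lmodType R) : cochain_complex :=
  {| cobj n := hom (X n) N; codiff n := hom_pre N (diff X n);
     codiffK := @hom_to_codiffK X N |}.

Section Augmented.
Variables (X : chain_complex) (M : lmodType R) (eps : {linear X 0 -> M}).
Hypothesis eps_diff : forall x, eps (diff X 0 x) = 0.

Definition aug_obj n : lmodType R := if n is m.+1 then X m else M.
Definition aug_diff n : {linear aug_obj n.+1 -> aug_obj n} :=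
  match n return {linear aug_obj n.+1 -> aug_obj n} with
  | 0 => eps
  | m.+1 => diff X m
  end.
Fact aug_diffK n x : aug_diff n (aug_diff n.+1 x) = 0.
Proof. by case: n x => [|n] x /=; rewrite ?eps_diff ?diffK. Qed.

(* The complex X^+, shifted so that M sits in degree 0. *)
Definition augmented : chain_complex :=
  {| obj := aug_obj; diff := aug_diff; diffK := aug_diffK |}.
End Augmented.

End Complexes.

Section Semidualizing.
Variable R : comPzRingType.

Definition projective (P : lmodType R) :=
  forall (A B : lmodType R) (e : {linear A -> B}) (f : {linear P -> B}),
    surj e -> exists g : {linear P -> A}, forall x, e (g x) = f x.

Definition flat (F : lmodType R) :=
  forall (A B : lmodType R) (u : {linear A -> B}),
    injective u -> injective (tens_map (idfun : {linear F -> F}) u).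

Record projective_resolution (M : lmodType R) := ProjectiveResolution {
  pres :> chain_complex R;
  pres_aug : {linear pres 0 -> M};
  pres_augK : forall x, pres_aug (diff pres 0 x) = 0;
  pres_projective : forall n, projective (pres n);
  pres_exact : exact_complex (augmented pres_augK) }.

Definition Ext (M : lmodType R) (P : projective_resolution M) (N : lmodType R)
    (i : nat) : lmodType R :=
  cohomology (hom_to P N) i.

(* Ext is independent, up to isomorphism, of the projective resolution used to
   compute it; its vanishing is stated for all of them. *)
Definition Ext_vanishes (M N : lmodType R) (i : nat) :=
  forall (P : projective_resolution M) (x : Ext P N i), x = 0.

Definition semidualizing (C : lmodType R) :=
  [/\ finitely_generated C,
      bijective (homothety C) &
      forall i, (1 <= i)%N -> Ext_vanishes C C i].

Definition P_class (C X : lmodType R) :=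
  exists P : lmodType R, projective P /\ isomorphic X (tensor P C).

Definition F_class (C X : lmodType R) :=
  exists F : lmodType R, flat F /\ isomorphic X (tensor F C).

End Semidualizing.

Section RelativeTor.
Variable R : comPzRingType.
Implicit Type cls : lmodType R -> Prop.

Record proper_resolution cls (M : lmodType R) := ProperResolution {
  res :> chain_complex R;
  aug : {linear res 0 -> M};
  augK : forall x, aug (diff res 0 x) = 0;
  res_class : forall n, cls (res n);
  res_proper : forall Y, cls Y -> exact_complex (hom_from Y (augmented augK)) }.

Definition relTor cls (M : lmodType R) (Q : proper_resolution cls M)
    (N : lmodType R) (i : nat) : lmodType R :=
  homology (tens_complex Q N) i.

Definition lifts cls (M M' : lmodType R) (f : {linear M -> M'})
    (Q : proper_resolution cls M) (Q' : proper_resolution cls M')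
    (u : chain_map Q Q') :=
  forall x, aug Q' (u 0 x) = f (aug Q x).

(* Tor_i(f, g), computed with a chain map u; it only depends on f when u lifts
   f, since such a u is unique up to homotopy. *)
Definition relTor_map cls (M M' N N' : lmodType R)
    (Q : proper_resolution cls M) (Q' : proper_resolution cls M')
    (u : chain_map Q Q') (g : {linear N -> N'}) (i : nat) :
    {linear relTor Q N i -> relTor Q' N' i} :=
  homology_map (tens_chain_map u g) i.

End RelativeTor.

(* Main.v *)
From HB Require Import structures.
From mathcomp Require Import boolp functions.
From mathcomp Require Import all_boot all_order all_algebra.
Require Import Defs.

Set Implicit Arguments.
Unset Strict Implicit.
Unset Printing Implicit Defensive.

Import GRing.Theory.
Local Open Scope ring_scope.

(** Let Q be a proper P_C-resolution and G a proper F_C-resolution of M.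
Projective modules are flat, so every term of Q lies in F_C and the augmented
complex of G is Hom(Q n, -)-exact.  The usual lifting argument then yields a
chain map Q -> G over the identity of M ([comparison_exists]), and two chain
maps Q -> G' over the same map M -> M' are homotopic
([comparison_homotopic]).  The first fact defines the map Tor(Q) -> Tor(G); the
second makes it natural, because both ways around the naturality square are
induced by chain maps Q -> G' over the same f.

It remains to see that a chain map u : Q -> G over the identity becomes a
quasi-isomorphism after tensoring with N, that is, that cone(u) (x) N is exact.
Since C itself belongs to both classes, Hom(C, -) is exact on both augmented
resolutions, hence on cone(u) ([exact_cone_hom_from]); and the terms of cone(u)
lie in F_C.  So everything rests on [exact_F_class_tens]: if X is a bounded
below complex of modules in F_C and Hom(C, X) is exact, then X (x) N is exact.

To prove it, write K in F_C as F (x) C with F flat.  The coevaluation F ->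
Hom(C, F (x) C) is bijective ([coev_bij]).  Indeed C is finitely presented, R
being noetherian, and a finite presentation of C exhibits Hom(C, W) as a
kernel W^n -> W^m for every W; for W = C the homothety isomorphism turns this
into an exact sequence 0 -> R -> C^n -> C^m, which stays exact after tensoring
with F, and the kernel of F (x) C^n -> F (x) C^m is Hom(C, F (x) C).
Consequently Hom(C, K) is flat and the evaluation Hom(C, K) (x) C -> K is
bijective, so that X (x) N is isomorphic to Hom(C, X) (x) (C (x) N), the
tensor product of an exact bounded below complex of flat modules with a
module.  Such a product is exact ([exact_flat_tens]). *)

(** * Linear maps *)

Section LinearMaps.
Variable R : comPzRingType.

Lemma lin_inj (U V : lmodType R) (f : {linear U -> V}) :
  (forall x, f x = 0 -> x = 0) -> injective f.
Proof.
by move=> h x y e; apply/eqP; rewrite -subr_eq0; apply/eqP/h;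
  rewrite linearB e subrr.
Qed.

Lemma bij_linear_inv (U V : lmodType R) (f : {linear U -> V}) :
  bijective f -> exists g : {linear V -> U}, cancel f g /\ cancel g f.
Proof.
case=> g fK gK.
have gl : linear g by move=> a x y; rewrite -{1}[x]gK -{1}[y]gK -linearP fK.
by exists (mk_linear gl).
Qed.

Lemma isomorphicP (U V : lmodType R) : isomorphic U V ->
  exists (f : {linear U -> V}) (g : {linear V -> U}), cancel f g /\ cancel g f.
Proof. by case=> f /bij_linear_inv[g ?]; exists f, g. Qed.

Lemma inj_surj_bij (U V : Type) (f : U -> V) :
  injective f -> surj f -> bijective f.
Proof.
move=> fi fs; pose g y := projT1 (cid (fs y)).
have gK y : f (g y) = y by exact: projT2 (cid (fs y)).
by exists g => // x; apply: fi; rewrite gK.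
Qed.

End LinearMaps.

(** * Tensor products *)

Section TensorGenerators.
Variables (R : comPzRingType) (A B : lmodType R).

Definition pure_r (a : A) : {linear B -> tensor A B} :=
  mk_linear (pure_linear_r a).
Definition pure_l (b : B) : {linear A -> tensor A B} :=
  mk_linear (pure_linear_l b).

Lemma pureZl r a b : pure (r *: a) b = r *: pure a b :> tensor A B.
Proof. exact: (linearZ_LR (pure_l b)). Qed.

Lemma pureZr r a b : pure a (r *: b) = r *: pure a b :> tensor A B.
Proof. exact: (linearZ_LR (pure_r a)). Qed.

Lemma tensor_sum (z : tensor A B) :
  exists s : seq (A * B), z = \sum_(p <- s) pure p.1 p.2.
Proof. by elim/tensor_ind: z => s; exists s; rewrite tensor_piE. Qed.

Lemma tens_map_id (z : tensor A B) : tens_map idfun idfun z = z.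
Proof.
rewrite -[RHS]/((idfun : {linear _ -> _}) z).
by apply: tens_ext => a b; rewrite tens_mapE.
Qed.

End TensorGenerators.

Section TensorMapAlgebra.
Variables (R : comPzRingType) (A A' B B' : lmodType R).

Lemma tens_map_addl (f f' : {linear A -> A'}) (g : {linear B -> B'}) z :
  tens_map (f \+ f' : {linear A -> A'}) g z = tens_map f g z + tens_map f' g z.
Proof.
rewrite -[RHS]/((tens_map f g \+ tens_map f' g : {linear _ -> _}) z).
apply: tens_ext => a b.
rewrite -[RHS]/(tens_map f g (pure a b) + tens_map f' g (pure a b)) !tens_mapE.
exact: (linearD (pure_l _ (g b)) (f a) (f' a)).
Qed.

Lemma tens_map_subl (f f' : {linear A -> A'}) (g : {linear B -> B'}) z :
  tens_map (f \- f' : {linear A -> A'}) g z = tens_map f g z - tens_map f' g z.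
Proof.
rewrite -[RHS]/((tens_map f g \- tens_map f' g : {linear _ -> _}) z).
apply: tens_ext => a b.
rewrite -[RHS]/(tens_map f g (pure a b) - tens_map f' g (pure a b)) !tens_mapE.
exact: (linearB (pure_l _ (g b)) (f a) (f' a)).
Qed.

Lemma tens_map0l (g : {linear B -> B'}) z :
  tens_map (\0 : {linear A -> A'}) g z = 0.
Proof.
rewrite -[RHS]/((\0 : {linear _ -> _}) z).
by apply: tens_ext => a b; rewrite tens_mapE [LHS]pure0l.
Qed.

Lemma tens_map0r (f : {linear A -> A'}) z :
  tens_map f (\0 : {linear B -> B'}) z = 0.
Proof.
rewrite -[RHS]/((\0 : {linear _ -> _}) z).
apply: tens_ext => a b; rewrite tens_mapE.
exact: (linear0 (pure_r _ (f a))).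
Qed.

End TensorMapAlgebra.

Section RightExact.
Variables (R : comPzRingType) (F A B : lmodType R) (f : {linear A -> B}).

Let idF : {linear F -> F} := idfun.
Let cok := coker_proj (tens_map idF f).

Let to_cok (x : F) : {linear coker f -> coker (tens_map idF f)}.
Proof.
apply: (@coker_lift _ _ _ f _ (cok \o pure_r B x : {linear B -> _})).
move=> u; rewrite -[LHS]/(cok (pure x (f u))).
by apply/coker_projP; exists (pure x u); rewrite tens_mapE.
Defined.

Let to_cokE x b : to_cok x (coker_proj f b) = cok (pure x b).
Proof. exact: coker_liftE. Qed.

(** The map F (x) coker f -> coker (F (x) f) induced by [to_cok] turns the
image of z in F (x) coker f into its class modulo the image of F (x) f; the
former being zero, so is the latter. *)
Lemma tensor_right_exact (z : tensor F B) :
  tens_map idF (coker_proj f) z = 0 -> exists y, tens_map idF f y = z.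
Proof.
have hr a : linear (to_cok a) by apply: linearP.
have hl b : linear (to_cok^~ b).
  move=> r x y; have [b' <-] := coker_proj_surj b.
  by rewrite !to_cokE pure_linear_l linearP.
move=> e; apply/coker_projP.
have <- : tens_lift hl hr (tens_map idF (coker_proj f) z) = cok z.
  pose q : {linear _ -> _} := tens_lift hl hr \o tens_map idF (coker_proj f).
  rewrite -[LHS]/(q z); apply: tens_ext => a b.
  rewrite -[LHS]/(tens_lift hl hr (tens_map idF (coker_proj f) (pure a b))).
  by rewrite tens_mapE tens_liftE to_cokE.
by rewrite e linear0.
Qed.

End RightExact.

Section TensorMapSquares.
Variable R : comPzRingType.

Lemma tens_map_compE (A A' A'' B B' B'' : lmodType R)
    (f' : {linear A' -> A''}) (f : {linear A -> A'}) (h : {linear A -> A''})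
    (g' : {linear B' -> B''}) (g : {linear B -> B'}) (k : {linear B -> B''}) z :
  (forall a, f' (f a) = h a) -> (forall b, g' (g b) = k b) ->
  tens_map f' g' (tens_map f g z) = tens_map h k z.
Proof. by move=> ef eg; rewrite tens_map_comp; apply: eq_tens_map. Qed.

Lemma tens_map_square (A A1 A2 A' B B1 B2 B' : lmodType R)
    (f1 : {linear A -> A1}) (f1' : {linear A1 -> A'})
    (f2 : {linear A -> A2}) (f2' : {linear A2 -> A'})
    (g1 : {linear B -> B1}) (g1' : {linear B1 -> B'})
    (g2 : {linear B -> B2}) (g2' : {linear B2 -> B'}) z :
  (forall a, f1' (f1 a) = f2' (f2 a)) -> (forall b, g1' (g1 b) = g2' (g2 b)) ->
  tens_map f1' g1' (tens_map f1 g1 z) = tens_map f2' g2' (tens_map f2 g2 z).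
Proof.
move=> ef eg; rewrite (tens_map_comp f2').
exact: tens_map_compE.
Qed.

Lemma tens_mapK (A A' B B' : lmodType R)
    (f : {linear A -> A'}) (f' : {linear A' -> A})
    (g : {linear B -> B'}) (g' : {linear B' -> B}) :
  cancel f f' -> cancel g g' -> cancel (tens_map f g) (tens_map f' g').
Proof.
move=> fK gK z; rewrite -[RHS]tens_map_id.
by apply: tens_map_compE => [a|b]; rewrite ?fK ?gK.
Qed.

End TensorMapSquares.

(** * Flat modules *)

Section Flatness.
Variable R : comPzRingType.

(** Exactness in the middle reduces to injectivity on the cokernel: exactness
at B says that g factors through an injection of coker f, which F preserves,
and right exactness handles the projection onto coker f. *)
Lemma flat_exact (F A B D : lmodType R) (f : {linear A -> B})
    (g : {linear B -> D}) (z : tensor F B) :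
  flat F -> (forall a, g (f a) = 0) ->
  (forall b, g b = 0 -> exists a, f a = b) ->
  tens_map (idfun : {linear F -> F}) g z = 0 ->
  exists y, tens_map (idfun : {linear F -> F}) f y = z.
Proof.
move=> Fflat gf ker_im e; apply: tensor_right_exact.
apply: (Fflat _ _ (coker_lift gf)); last first.
  rewrite linear0 -{}[RHS]e.
  by apply: tens_map_compE => // b; apply: coker_liftE.
apply: lin_inj => x; have [b <-] := coker_proj_surj x.
by rewrite coker_liftE => /ker_im h; apply/coker_projP.
Qed.

Lemma flat_retract (F F' : lmodType R) (i : {linear F -> F'})
    (p : {linear F' -> F}) :
  cancel i p -> flat F' -> flat F.
Proof.
move=> iK F'flat A B u u_inj x y e.
have iKt (E : lmodType R) (t : tensor F E) :
    tens_map p idfun (tens_map i idfun t) = t by apply: tens_mapK.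
rewrite -[x]iKt -[y]iKt; congr (tens_map _ _ _).
apply: (F'flat _ _ u u_inj).
have sq t : tens_map idfun u (tens_map i idfun t) =
            tens_map i idfun (tens_map idfun u t).
  exact: tens_map_square.
by rewrite !sq e.
Qed.

(** The map phi (x) A followed by the identification of R (x) A with A. *)
Definition contract (P A : lmodType R) (phi : {linear P -> R^o}) :
  {linear tensor P A -> A}.
Proof.
apply: (@tens_lift _ _ _ _ (fun p a => (phi p : R) *: a)).
- by move=> a r p q; rewrite linearP scalerDl scalerA.
- by move=> p r a b; rewrite scalerDr !scalerA mulrC.
Defined.

Lemma contractE (P A : lmodType R) (phi : {linear P -> R^o}) p (a : A) :
  contract A phi (pure p a) = (phi p : R) *: a.
Proof. exact: tens_liftE. Qed.

Lemma contract_natural (P A B : lmodType R) (phi : {linear P -> R^o})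
    (u : {linear A -> B}) z :
  contract B phi (tens_map idfun u z) = u (contract A phi z).
Proof.
rewrite -[LHS]/((contract B phi \o tens_map idfun u : {linear _ -> _}) z).
rewrite -[RHS]/((u \o contract A phi : {linear _ -> _}) z).
apply: tens_ext => p a.
rewrite -[LHS]/(contract B phi (tens_map idfun u (pure p a))).
by rewrite -[RHS]/(u (contract A phi (pure p a))) tens_mapE !contractE linearZ.
Qed.

End Flatness.

(** * Projective modules are flat *)

(** Free modules on infinite sets are finitely supported functions here, so that
evaluation at a point gives the coordinate forms of a dual basis at once. *)
Section FreeModule.
Variables (R : comPzRingType) (T : choiceType).

Definition fin_supp : {pred T -> R^o} :=
  fun f => `[< exists s : seq T, forall x, x \notin s -> f x = 0 >].

Fact fin_supp_closed : submod_closed fin_supp.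
Proof.
split=> [|a f g]; first by apply/asboolP; exists [::].
move=> /asboolP[s hs] /asboolP[t ht]; apply/asboolP; exists (s ++ t) => x.
rewrite mem_cat negb_or => /andP[xs xt].
by rewrite -[LHS]/(a *: f x + g x) hs // ht // scaler0 addr0.
Qed.
HB.instance Definition _ := GRing.isSubmodClosed.Build R (T -> R^o) fin_supp
  fin_supp_closed.

Record free_module : Type :=
  Free { free_val : T -> R^o; _ : free_val \in fin_supp }.
HB.instance Definition _ := [isSub for free_val].
HB.instance Definition _ := [Choice of free_module by <:].
HB.instance Definition _ := [SubChoice_isSubLmodule of free_module by <:].

Lemma free_supp (f : free_module) :
  exists s : seq T, forall x, x \notin s -> val f x = 0.
Proof. by case: f => f /= /asboolP. Qed.

Definition free_coef (x : T) : {linear free_module -> R^o}.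
Proof.
apply: (@mk_linear _ _ _ (fun f => val f x)) => a f g.
by rewrite linearP.
Defined.

Fact basis_subproof (x : T) :
  (fun y => (y == x)%:R : R^o) \in fin_supp.
Proof.
by apply/asboolP; exists [:: x] => y; rewrite inE => /negPf ->.
Qed.
Definition free_basis (x : T) : free_module := Free (basis_subproof x).

Variables (M : lmodType R) (g : T -> M).

Lemma free_sum_supp (f : free_module) (s t : seq T) :
  (forall x, x \notin s -> val f x = 0) ->
  (forall x, x \notin t -> val f x = 0) -> uniq s -> uniq t ->
  \sum_(x <- s) free_coef x f *: g x = \sum_(x <- t) free_coef x f *: g x.
Proof.
move=> hs ht us ut.
have nz r : \sum_(x <- r) free_coef x f *: g x =
            \sum_(x <- [seq x <- r | free_coef x f != 0]) free_coef x f *: g x.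
  rewrite big_filter [RHS]big_mkcond /=.
  by apply: eq_bigr => x _; case: eqP => //= ->; rewrite scale0r.
rewrite nz [RHS]nz; apply/perm_big/uniq_perm; rewrite ?filter_uniq // => x.
rewrite !mem_filter; case: eqP => //= nz_x.
have -> : x \in s by apply/negPn/negP => /hs.
by symmetry; apply/negPn/negP => /ht.
Qed.

(* The support is obtained by choice; [free_sum_supp] makes the value
   independent of it, which is what linearity needs. *)
Let sum_over (f : free_module) : M :=
  \sum_(x <- undup (projT1 (cid (free_supp f)))) free_coef x f *: g x.

Let sum_overE (f : free_module) (s : seq T) :
  (forall x, x \notin s -> val f x = 0) -> uniq s ->
  sum_over f = \sum_(x <- s) free_coef x f *: g x.
Proof.
move=> hs us; apply: free_sum_supp; rewrite ?undup_uniq // => x.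
by rewrite mem_undup => h; apply: projT2 (cid (free_supp f)) x h.
Qed.

Fact free_lift_linear : linear sum_over.
Proof.
move=> a f h; have [s hs] := free_supp f; have [t ht] := free_supp h.
have sc x : x \notin undup (s ++ t) -> val f x = 0 /\ val h x = 0.
  by rewrite mem_undup mem_cat negb_or => /andP[/hs ? /ht ?].
rewrite (@sum_overE _ (undup (s ++ t))) ?undup_uniq //; last first.
  move=> x /sc[fx hx]; rewrite linearP.
  by rewrite -[LHS]/(a *: val f x + val h x) fx hx scaler0 addr0.
rewrite (@sum_overE f (undup (s ++ t))) ?undup_uniq //; last by move=> x /sc[].
rewrite (@sum_overE h (undup (s ++ t))) ?undup_uniq //; last by move=> x /sc[].
rewrite scaler_sumr -big_split; apply: eq_bigr => x _.
have -> : free_coef x (a *: f + h) = a * free_coef x f + free_coef x h.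
  exact: linearP.
by rewrite scalerDl -scalerA.
Qed.
Definition free_lift : {linear free_module -> M} := mk_linear free_lift_linear.

Lemma free_liftE (f : free_module) (s : seq T) :
  (forall x, x \notin s -> val f x = 0) -> uniq s ->
  free_lift f = \sum_(x <- s) free_coef x f *: g x.
Proof. exact: sum_overE. Qed.

Lemma free_lift_basis x : free_lift (free_basis x) = g x.
Proof.
rewrite (@free_liftE _ [:: x]) // => [|y].
  by rewrite big_seq1 /= eqxx scale1r.
by rewrite inE /= => /negPf ->.
Qed.

End FreeModule.
Arguments free_coef {R T} x.
Arguments free_basis R {T} x.

Section Projective.
Variables (R : comPzRingType) (P : lmodType R).

(** A section of the free cover of P by its own elements, read in coordinates.
The expansion is stated for every duplicate-free t containing s so that the
expansions of finitely many elements can share one index sequence. *)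
Lemma dual_basis : projective P ->
  exists phi : P -> {linear P -> R^o}, forall p, exists s : seq P,
    forall t, uniq t -> {subset s <= t} ->
      p = \sum_(x <- t) (phi x p : R) *: x.
Proof.
pose e := free_lift (idfun : P -> P).
have e_surj : surj e.
  by move=> x; exists (free_basis R x); apply: free_lift_basis.
case/(_ _ _ e idfun e_surj) => sigma sigmaK.
exists (fun x => free_coef x \o sigma : {linear P -> R^o}) => p.
have [s hs] := free_supp (sigma p); exists s => t ut st.
rewrite -[LHS](sigmaK p) /e (@free_liftE _ _ _ _ _ t) // => x.
by move=> xt; apply: hs; apply: contra xt; apply: st.
Qed.

(** A dual basis expands z as a finite sum of the x (x) (phi x (x) A)(z).  These
coefficients lie in A and are compatible with u, so they vanish as soon as the
image of z in P (x) B does and u is injective. *)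
Lemma projective_flat : projective P -> flat P.
Proof.
case/dual_basis => phi phiP A B u u_inj; apply: lin_inj => z e.
have [s zE] : exists s : seq P, forall t, uniq t -> {subset s <= t} ->
    z = \sum_(x <- t) pure x (contract A (phi x) z).
  have [w ->] := tensor_sum z.
  elim: w {z e} => [|[p a] w [s IHs]].
    exists [::] => t _ _; rewrite big_nil big1 // => x _.
    by rewrite linear0; apply: (linear0 (pure_r _ _)).
  have [s' hs'] := phiP p; exists (s ++ s') => t ut st.
  rewrite big_cons -[pure (p, a).1 (p, a).2]/(pure p a).
  set zw := \sum_(p <- w) _ in IHs *.
  have st' x : x \in s' -> x \in t.
    by move=> xs; apply: st; rewrite mem_cat xs orbT.
  rewrite [X in pure p a + X = _](IHs t ut) => [|x xs]; last first.
    by apply: st; rewrite mem_cat xs.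
  rewrite [X in pure X a + _ = _](hs' t ut st').
  have -> : pure (\sum_(x <- t) (phi x p : R) *: x) a =
            \sum_(x <- t) pure x ((phi x p : R) *: a).
    rewrite -[LHS]/(pure_l _ a _) linear_sum; apply: eq_bigr => x _.
    by rewrite linearZ -[RHS]/(pure_r _ x _) linearZ.
  rewrite -big_split; apply: eq_bigr => x _.
  by rewrite linearD contractE; symmetry; apply: (linearD (pure_r _ x)).
rewrite (zE (undup s)) ?undup_uniq //; last by move=> x; rewrite mem_undup.
apply: big1 => x _; have -> : contract A (phi x) z = 0.
  by apply: u_inj; rewrite -contract_natural e !linear0.
exact: (linear0 (pure_r _ _)).
Qed.

End Projective.

(** * Finite direct sums and tensor products *)

Section DirectSums.
Variable R : comPzRingType.

Section Binary.
Variables U V : lmodType R.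

Definition pair_l : {linear U -> (U * V)%type}.
Proof.
apply: (@mk_linear _ _ _ (fun u => (u, 0))) => a x y.
by congr pair; rewrite /= scaler0 addr0.
Defined.

Definition pair_r : {linear V -> (U * V)%type}.
Proof.
apply: (@mk_linear _ _ _ (fun v => (0, v))) => a x y.
by congr pair; rewrite /= scaler0 addr0.
Defined.

Let linfst : {linear (U * V)%type -> U} := fst.
Let linsnd : {linear (U * V)%type -> V} := snd.

Lemma tensor_pairE (N : lmodType R) (z : tensor (U * V)%type N) :
  z = tens_map pair_l idfun (tens_map linfst idfun z) +
      tens_map pair_r idfun (tens_map linsnd idfun z).
Proof.
rewrite !tens_map_comp -tens_map_addl -[LHS]tens_map_id.
by apply: eq_tens_map => // -[u v]; congr pair; rewrite /= ?addr0 ?add0r.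
Qed.

Lemma flat_prod : flat U -> flat V -> flat (U * V)%type.
Proof.
move=> Uf Vf A B u u_inj; apply: lin_inj => z e.
rewrite [z]tensor_pairE.
have -> : tens_map linfst idfun z = 0.
  apply: (Uf _ _ u u_inj).
  rewrite linear0 -(linear0 (tens_map linfst idfun)) -e.
  exact: tens_map_square.
have -> : tens_map linsnd idfun z = 0; last by rewrite !linear0 addr0.
apply: (Vf _ _ u u_inj); rewrite linear0 -(linear0 (tens_map linsnd idfun)) -e.
exact: tens_map_square.
Qed.

End Binary.

Section Powers.
Variables (n : nat) (U : lmodType R).
Local Notation power := {ffun 'I_n -> U}.

Fact pow_proj_linear (k : 'I_n) : linear (fun v : power => v k).
Proof. by move=> a x y; rewrite !ffunE. Qed.
Definition pow_proj (k : 'I_n) : {linear power -> U} :=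
  mk_linear (pow_proj_linear k).

Fact pow_inj_linear (k : 'I_n) :
  linear (fun u : U => [ffun i => if i == k then u else 0] : power).
Proof.
move=> a x y; apply/ffunP => i; rewrite !ffunE.
by case: ifP => _ //; rewrite scaler0 addr0.
Qed.
Definition pow_inj (k : 'I_n) : {linear U -> power} :=
  mk_linear (pow_inj_linear k).

Lemma pow_proj_inj i k u : pow_proj i (pow_inj k u) = if i == k then u else 0.
Proof. by rewrite /= ffunE. Qed.

Lemma pow_sum v : v = \sum_k pow_inj k (pow_proj k v).
Proof.
apply/ffunP => i; rewrite -[RHS]/(pow_proj i _) linear_sum.
rewrite (bigD1 i) //= !ffunE eqxx big1 ?addr0 // => k /negPf ki.
by rewrite ffunE eq_sym ki.
Qed.

Lemma tensor_pow_sum (F : lmodType R) (z : tensor F power) :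
  z = \sum_k tens_map idfun (pow_inj k) (tens_map idfun (pow_proj k) z).
Proof.
have [w ->] := tensor_sum z; elim: w => [|[x v] w IHw].
  by rewrite big_nil; symmetry; apply: big1 => k _; rewrite !linear0.
rewrite big_cons {1}IHw -[pure _ _]/(pure x v); set y := \sum_(p <- w) _.
rewrite [in LHS](pow_sum v) -[pure x _]/(pure_r _ x _) linear_sum -big_split.
apply: eq_bigr => k _; rewrite !linearD !tens_mapE.
by [].
Qed.

Lemma tensor_pow_eq0 (F : lmodType R) (z : tensor F power) :
  (forall k, tens_map (idfun : {linear F -> F}) (pow_proj k) z = 0) -> z = 0.
Proof.
by move=> e; rewrite [z]tensor_pow_sum big1 // => k _; rewrite e linear0.
Qed.

End Powers.
End DirectSums.

Section TensorUnit.
Variables (R : comPzRingType) (F : lmodType R).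

Definition tensor_unit : {linear tensor F R^o -> F}.
Proof.
apply: (@tens_lift _ _ _ _ (fun x (r : R^o) => (r : R) *: x)).
- by move=> r a x y; rewrite scalerDr !scalerA mulrC.
- by move=> x a r s; rewrite scalerDl scalerA.
Defined.

Lemma tensor_unitE x (r : R^o) : tensor_unit (pure x r) = (r : R) *: x.
Proof. exact: tens_liftE. Qed.

Lemma tensor_unitK (z : tensor F R^o) :
  pure (tensor_unit z) (1 : R^o) = z.
Proof.
rewrite -[LHS]/((pure_l _ (1 : R^o) \o tensor_unit : {linear _ -> _}) z).
rewrite -[RHS]/((idfun : {linear _ -> _}) z); apply: tens_ext => x r.
rewrite -[LHS]/(pure_l _ (1 : R^o) (tensor_unit (pure x r))) tensor_unitE.
rewrite -[LHS]/(pure ((r : R) *: x) (1 : R^o)) pureZl -pureZr.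
by congr pure; apply: mulr1.
Qed.

Lemma tens_map_scale (A : lmodType R) r (z : tensor F A) :
  tens_map idfun (r \*: idfun : {linear A -> A}) z = r *: z.
Proof.
rewrite -[RHS]/((r \*: idfun : {linear _ -> _}) z); apply: tens_ext => x a.
rewrite -[RHS]/(r *: pure x a) tens_mapE.
exact: pureZr.
Qed.

End TensorUnit.

(** * Modules of finite presentation *)

Section Relations.
Variable R : comPzRingType.

(** Submodules of R^n are finitely generated, by induction on n: the first
coordinates of the elements of S form an ideal I, and the elements of S with
first coordinate zero form a submodule of the next smaller power.  Generators
of S are lifts of generators of I together with generators of that submodule. *)
Lemma noetherian_power_fg : noetherian R ->
  forall n (S : ('I_n -> R) -> Prop),
    S (fun=> 0) ->
    (forall a x y, S x -> S y -> S (fun i => a * x i + y i)) ->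
    exists m (rho : 'I_m -> 'I_n -> R), (forall j, S (rho j)) /\
      forall x, S x -> exists b : 'I_m -> R,
        forall i, x i = \sum_j b j * rho j i.
Proof.
move=> noethR; elim=> [|n IHn] S S0 Slin.
  by exists 0, (fun _ _ => 0); split=> [[]|x _] //; exists (fun=> 0) => -[].
pose I r := exists2 x, S x & x ord0 = r.
have [||k [g gP]] := noethR I.
- by exists (fun=> 0).
- move=> a _ _ [x Sx <-] [y Sy <-].
  by exists (fun i => a * x i + y i) => //; apply: Slin.
have gI j : I (g j).
  apply/gP; exists (fun i => (i == j)%:R).
  rewrite (bigD1 j) //= eqxx mul1r big1 ?addr0 // => i /negPf ->.
  by rewrite mul0r.
have lift_g j : {x | S x /\ x ord0 = g j}.
  by apply: cid; have [x] := gI j; exists x.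
pose xg j := projT1 (lift_g j).
have [Sxg xg0] : (forall j, S (xg j)) /\ (forall j, xg j ord0 = g j).
  by split=> j; have [] := projT2 (lift_g j).
(* R^n embedded in R^(n+1) as the vectors with first coordinate zero. *)
pose ext (y : 'I_n -> R) i := if unlift ord0 i is Some i' then y i' else 0.
have [||m [rho [Srho rhoP]]] := IHn (fun y => S (ext y)).
- suff -> : ext (fun=> 0) = fun=> 0 by [].
  by apply: funext => i; rewrite /ext; case: unlift.
- move=> a x y Sx Sy; have := Slin a _ _ Sx Sy.
  congr S; apply: funext => i; rewrite /ext.
  by case: unlift => //; rewrite mulr0 addr0.
exists (k + m)%N, (fun j => match split j with
                   | inl j1 => xg j1 | inr j2 => ext (rho j2) end).
split=> [j|x Sx]; first by case: split.
have [a xa] : exists a : 'I_k -> R, x ord0 = \sum_(i < k) a i * g i.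
  by apply/gP; exists x.
(* Subtracting the lifts that account for x ord0 leaves a vector of S with
   first coordinate zero. *)
pose y i := x i - \sum_j a j * xg j i.
have Sy : S y.
  have Scomb p (c : 'I_p -> R) (f : 'I_p -> 'I_n.+1 -> R) :
      (forall j, S (f j)) -> S (fun i => x i - \sum_j c j * f j i).
    elim: p c f => [|p IHp] c f Sf.
      by congr S: Sx; apply: funext => i; rewrite big_ord0 subr0.
    have := Slin (- c ord0) _ _ (Sf ord0)
      (IHp (c \o lift ord0) (f \o lift ord0) (fun j => Sf _)).
    congr S; apply: funext => i.
    by rewrite big_ord_recl opprD mulNr addrCA.
  exact: Scomb.
have y0 : y ord0 = 0.
  rewrite /y xa; apply/eqP; rewrite subr_eq0; apply/eqP/eq_bigr => j _.
  by rewrite xg0.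
have yE : y = ext (y \o lift ord0).
  by apply: funext => i; rewrite /ext; case: unliftP => [i' ->|->].
have [b bP] : exists b : 'I_m -> R,
    forall i, y (lift ord0 i) = \sum_j b j * rho j i.
  by apply: rhoP; rewrite -yE.
exists (fun j => match split j with inl j1 => a j1 | inr j2 => b j2 end) => i.
rewrite big_split_ord /=.
have -> : x i = \sum_j a j * xg j i + y i by rewrite addrC subrK.
congr (_ + _).
  apply: eq_bigr => j _; case: split_ordP => j' /eqP.
    by rewrite eq_lshift => /eqP ->.
  by rewrite eq_lrshift.
rewrite yE /ext; case: unliftP => [i' ->|->].
  rewrite -[LHS]/(y _) bP; apply: eq_bigr => j _.
  case: split_ordP => j' /eqP; rewrite ?eq_rshift ?eq_rlshift // => /eqP <-.
  by rewrite liftK.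
rewrite big1 // => j _.
case: split_ordP => j' /eqP; rewrite ?eq_rshift ?eq_rlshift // => /eqP <-.
by rewrite unlift_none mulr0.
Qed.

End Relations.

Section FinitePresentation.
Variables (R : comPzRingType) (C : lmodType R).

Record presentation (n m : nat) (g : 'I_n -> C) (rho : 'I_m -> 'I_n -> R) :
    Prop := Presentation {
  presentation_gen : forall x, exists a : 'I_n -> R, x = \sum_k a k *: g k;
  presentation_rel : forall j, \sum_k rho j k *: g k = 0;
  presentation_relP : forall a, \sum_k a k *: g k = 0 ->
    exists b : 'I_m -> R, forall k, a k = \sum_j b j * rho j k }.

Lemma noetherian_presentation : noetherian R -> finitely_generated C ->
  exists n m (g : 'I_n -> C) (rho : 'I_m -> 'I_n -> R), presentation g rho.
Proof.
move=> noethR [n [g gen]].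
pose S (a : 'I_n -> R) := \sum_k a k *: g k = 0.
have [||m [rho [rel relP]]] := noetherian_power_fg noethR (S := S).
- by apply: big1 => k _; rewrite scale0r.
- move=> a x y Sx Sy.
  transitivity (a *: (\sum_k x k *: g k) + \sum_k y k *: g k).
    rewrite scaler_sumr -big_split; apply: eq_bigr => k _.
    by rewrite scalerDl -scalerA.
  by rewrite Sx Sy scaler0 addr0.
by exists n, m, g, rho.
Qed.

Variables (n m : nat) (g : 'I_n -> C) (rho : 'I_m -> 'I_n -> R).
Hypothesis presC : presentation g rho.

Lemma eq_on_generators (W : lmodType R) (f f' : {linear C -> W}) :
  (forall k, f (g k) = f' (g k)) -> f =1 f'.
Proof.
move=> e x; have [a ->] := presentation_gen presC x.
by rewrite !linear_sum; apply: eq_bigr => k _; rewrite !linearZ e.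
Qed.

(** The universal property of the presentation.  Coordinates of the elements of
C on the generators are only chosen, not canonical; the relations are exactly
what makes the value independent of that choice. *)
Lemma presented_map (W : lmodType R) (w : 'I_n -> W) :
  (forall j, \sum_k rho j k *: w k = 0) ->
  exists h : {linear C -> W}, forall k, h (g k) = w k.
Proof.
move=> relw.
pose coord x := projT1 (cid (presentation_gen presC x)).
have coordE x : x = \sum_k coord x k *: g k.
  exact: projT2 (cid (presentation_gen presC x)).
have rel0 a : \sum_k a k *: g k = 0 -> \sum_k a k *: w k = 0.
  move/(presentation_relP presC) => [b ab].
  transitivity (\sum_k \sum_j b j *: (rho j k *: w k)).
    apply: eq_bigr => k _; rewrite ab scaler_suml.
    by apply: eq_bigr => j _; rewrite scalerA.
  by rewrite exchange_big big1 //= => j _; rewrite -scaler_sumr relw scaler0.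
have wd a b : \sum_k a k *: g k = \sum_k b k *: g k ->
              \sum_k a k *: w k = \sum_k b k *: w k.
  move=> e; apply/eqP; rewrite -subr_eq0 -sumrB; apply/eqP.
  under eq_bigr do rewrite -scalerBl; apply: (rel0 (fun k => a k - b k)).
  under eq_bigr do rewrite scalerBl.
  by rewrite sumrB e subrr.
have lin : linear (fun x => \sum_k coord x k *: w k).
  move=> r x y; transitivity (\sum_k (r * coord x k + coord y k) *: w k).
    apply: wd; rewrite -coordE {1}[x]coordE {1}[y]coordE scaler_sumr -big_split.
    by apply: eq_bigr => k _; rewrite scalerDl -scalerA.
  rewrite scaler_sumr -big_split.
  by apply: eq_bigr => k _; rewrite scalerDl -scalerA.
exists (mk_linear lin) => k /=.
transitivity (\sum_i (i == k)%:R *: w i).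
  apply: wd; rewrite -coordE (bigD1 k) //= eqxx scale1r big1 ?addr0 // => i.
  by move/negPf ->; rewrite scale0r.
rewrite (bigD1 k) //= eqxx scale1r big1 ?addr0 // => i.
by move/negPf ->; rewrite scale0r.
Qed.

(* The sequence R -> C^n -> C^m below is Hom(R^m -> R^n -> C, C) with Hom(C, C)
   replaced by R along the homothety; it is exact with injective first map. *)
Fact generator_vector_linear :
  linear (fun r : R^o => [ffun k => (r : R) *: g k] : {ffun 'I_n -> C}).
Proof.
by move=> a r s; apply/ffunP => k; rewrite !ffunE scalerDl scalerA.
Qed.
Let delta : {linear R^o -> {ffun 'I_n -> C}} :=
  mk_linear generator_vector_linear.

Fact relations_linear :
  linear (fun v : {ffun 'I_n -> C} =>
            [ffun j => \sum_k rho j k *: v k] : {ffun 'I_m -> C}).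
Proof.
move=> a v w; apply/ffunP => j; rewrite !ffunE scaler_sumr -big_split.
by apply: eq_bigr => k _; rewrite !ffunE scalerDr !scalerA mulrC.
Qed.
Let rels : {linear {ffun 'I_n -> C} -> {ffun 'I_m -> C}} :=
  mk_linear relations_linear.

Let rels_delta r : rels (delta r) = 0.
Proof.
apply/ffunP => j; rewrite !ffunE.
transitivity ((r : R) *: \sum_k rho j k *: g k).
  rewrite scaler_sumr; apply: eq_bigr => k _.
  by rewrite ffunE !scalerA mulrC.
by rewrite (presentation_rel presC) scaler0.
Qed.

Hypothesis homothety_bij : bijective (homothety C).

Let delta_inj : injective delta.
Proof.
apply: lin_inj => r e; apply: (bij_inj homothety_bij).
apply: linear_eqP; apply: eq_on_generators => k.
transitivity (delta r k); first by rewrite ffunE.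
by rewrite e ffunE; symmetry; apply: scale0r.
Qed.

Let rels_exact v : rels v = 0 -> exists r, delta r = v.
Proof.
move=> e; have [j|h hv] := @presented_map _ v.
  by have := congr1 (fun u : {ffun 'I_m -> C} => u j) e; rewrite !ffunE.
case: homothety_bij => psi _ psiK; exists (psi h); apply/ffunP => k.
rewrite ffunE -hv.
exact: (congr1 (fun f : hom C C => hom_fun f (g k)) (psiK h)).
Qed.

Variable F : lmodType R.

Fact coev_linear : linear (fun x : F => pure_r C x : hom C (tensor F C)).
Proof. by move=> a x y; apply: linear_eqP => c; apply: pure_linear_l. Qed.
Definition coev : {linear F -> hom C (tensor F C)} := mk_linear coev_linear.

Lemma coevE x c : hom_fun (coev x) c = pure x c.
Proof. by []. Qed.

Hypothesis Fflat : flat F.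

(** If x (x) c = 0 for all c, then x (x) 1 in F (x) R dies in F (x) C^n, into
which F (x) R embeds by flatness. *)
Lemma coev_inj : injective coev.
Proof.
apply: lin_inj => x e.
have ec (c : C) : pure x c = 0 by rewrite -coevE e.
have : pure x (1 : R^o) = 0.
  apply: (Fflat delta_inj); rewrite linear0 tens_mapE.
  apply: tensor_pow_eq0 => k; rewrite tens_mapE.
  exact: ec.
move/(congr1 (@tensor_unit _ F)); rewrite tensor_unitE linear0.
by rewrite scale1r.
Qed.

(** The values of h on the generators assemble into w in F (x) C^n; w is killed
by the relations because h is linear, hence comes from F (x) R = F by
exactness. *)
Lemma coev_surj : surj coev.
Proof.
move=> h.
pose w : tensor F {ffun 'I_n -> C} :=
  \sum_k tens_map idfun (pow_inj _ k) (hom_fun h (g k)).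
have wk k : tens_map idfun (pow_proj _ k) w = hom_fun h (g k).
  rewrite linear_sum (bigD1 k) // big1 => [|i /negPf ik].
    rewrite [LHS]addr0 -[RHS]tens_map_id; apply: tens_map_compE => // c.
    by rewrite pow_proj_inj eqxx.
  rewrite -[RHS](tens_map0r C idfun (hom_fun h (g i))).
  apply: tens_map_compE => // c.
  by rewrite pow_proj_inj eq_sym ik.
have : tens_map idfun rels w = 0.
  apply: tensor_pow_eq0 => j.
  transitivity (\sum_k rho j k *: hom_fun h (g k)).
    rewrite /w (linear_sum (tens_map idfun rels)) linear_sum.
    apply: eq_bigr => k _.
    rewrite -(tens_map_scale (rho j k)) tens_map_comp.
    apply: tens_map_compE => // c; rewrite /= ffunE (bigD1 k) //= ffunE eqxx.
    by rewrite big1 ?addr0 // => i /negPf ik; rewrite ffunE ik scaler0.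
  transitivity (hom_fun h (\sum_k rho j k *: g k)).
    by rewrite linear_sum; apply: eq_bigr => k _; rewrite linearZ.
  by rewrite (presentation_rel presC) linear0.
case/(flat_exact Fflat rels_delta rels_exact) => y yw.
exists (tensor_unit F y); apply: linear_eqP; apply: eq_on_generators => k.
rewrite -wk -yw -{2}[y]tensor_unitK !tens_mapE.
by rewrite -[LHS]/(pure (tensor_unit F y) (g k)) /= ffunE scale1r.
Qed.

Lemma coev_bij : bijective coev.
Proof. exact: inj_surj_bij coev_inj coev_surj. Qed.

End FinitePresentation.

(** * Associativity of the tensor product *)

Section Associativity.
Variables (R : comPzRingType) (A B D : lmodType R).

Fact assoc_l_linear (x : tensor B D) :
  linear (fun a : A => tens_map (pure_r B a) (idfun : {linear D -> D}) x).
Proof.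
move=> r a a'.
transitivity ((r \*: tens_map (pure_r B a) idfun \+ tens_map (pure_r B a') idfun
   : {linear tensor B D -> tensor (tensor A B) D}) x); last by [].
apply: tens_ext => b d.
rewrite -[RHS]/(r *: tens_map (pure_r B a) idfun (pure b d) +
                tens_map (pure_r B a') idfun (pure b d)) !tens_mapE -pureZl.
rewrite -[LHS]/(pure (pure (r *: a + a') b) d) pure_linear_l.
exact: (linearD (pure_l _ d)).
Qed.

Definition assoc : {linear tensor A (tensor B D) -> tensor (tensor A B) D} :=
  tens_lift assoc_l_linear (fun a => linearP (tens_map (pure_r B a) idfun)).

Lemma assocE a x : assoc (pure a x) = tens_map (pure_r B a) idfun x.
Proof. exact: tens_liftE. Qed.

Fact assoc_r_linear (z : tensor A B) :
  linear (fun d : D => tens_map (idfun : {linear A -> A}) (pure_l B d) z).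
Proof.
move=> r d d'.
transitivity ((r \*: tens_map idfun (pure_l B d) \+ tens_map idfun (pure_l B d')
   : {linear tensor A B -> tensor A (tensor B D)}) z); last by [].
apply: tens_ext => a b.
rewrite -[RHS]/(r *: tens_map idfun (pure_l B d) (pure a b) +
                tens_map idfun (pure_l B d') (pure a b)) !tens_mapE -pureZr.
rewrite -[LHS]/(pure a (pure b (r *: d + d'))) pure_linear_r.
exact: (linearD (pure_r _ a)).
Qed.

Definition assoc_inv :
    {linear tensor (tensor A B) D -> tensor A (tensor B D)} :=
  tens_lift (fun d => linearP (tens_map idfun (pure_l B d))) assoc_r_linear.

Lemma assoc_invE z d : assoc_inv (pure z d) = tens_map idfun (pure_l B d) z.
Proof. exact: tens_liftE. Qed.

Lemma assocK : cancel assoc assoc_inv.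
Proof.
move=> z; rewrite -[RHS]/((idfun : {linear _ -> _}) z).
rewrite -[LHS]/((assoc_inv \o assoc : {linear _ -> _}) z).
apply: tens_ext => a x.
rewrite -[RHS]/(pure_r _ a x) -[LHS]/(assoc_inv (assoc (pure a x))) assocE.
rewrite -[LHS]/((assoc_inv \o tens_map (pure_r B a) idfun : {linear _ -> _}) x).
apply: tens_ext => b d.
rewrite -[LHS]/(assoc_inv (tens_map (pure_r B a) idfun (pure b d))) tens_mapE.
by rewrite assoc_invE tens_mapE.
Qed.

Lemma assoc_invK : cancel assoc_inv assoc.
Proof.
move=> z; rewrite -[RHS]/((idfun : {linear _ -> _}) z).
rewrite -[LHS]/((assoc \o assoc_inv : {linear _ -> _}) z).
apply: tens_ext => x d.
rewrite -[RHS]/(pure_l _ d x) -[LHS]/(assoc (assoc_inv (pure x d))) assoc_invE.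
rewrite -[LHS]/((assoc \o tens_map idfun (pure_l B d) : {linear _ -> _}) x).
apply: tens_ext => a b.
rewrite -[LHS]/(assoc (tens_map idfun (pure_l B d) (pure a b))) tens_mapE.
by rewrite assocE tens_mapE.
Qed.

End Associativity.

Lemma assoc_natural (R : comPzRingType) (A A' B D : lmodType R)
    (f : {linear A -> A'}) (z : tensor A (tensor B D)) :
  assoc A' B D (tens_map f idfun z) =
  tens_map (tens_map f idfun) idfun (assoc A B D z).
Proof.
rewrite -[LHS]/((assoc A' B D \o tens_map f idfun : {linear _ -> _}) z).
rewrite -[RHS]/((tens_map (tens_map f idfun) idfun \o assoc A B D
  : {linear _ -> _}) z).
apply: tens_ext => a x.
rewrite -[LHS]/(assoc A' B D (tens_map f idfun (pure a x))).
rewrite -[RHS]/(tens_map (tens_map f idfun) idfun (assoc A B D (pure a x))).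
rewrite tens_mapE !assocE; symmetry; apply: tens_map_compE => // b.
exact: tens_mapE.
Qed.

(** * Evaluation on the class F_C *)

Section Evaluation.
Variables (R : comPzRingType) (C : lmodType R).

Fact ev_l_linear (K : lmodType R) (c : C) :
  linear (fun f : hom C K => hom_fun f c).
Proof. by []. Qed.
Definition ev (K : lmodType R) : {linear tensor (hom C K) C -> K} :=
  tens_lift (@ev_l_linear K) (fun f => linearP (hom_fun f)).

Lemma evE (K : lmodType R) (f : hom C K) c : ev K (pure f c) = hom_fun f c.
Proof. exact: tens_liftE. Qed.

Lemma ev_natural (K K' : lmodType R) (f : {linear K -> K'}) z :
  ev K' (tens_map (hom_post C f) idfun z) = f (ev K z).
Proof.
rewrite -[LHS]/((ev K' \o tens_map (hom_post C f) idfun : {linear _ -> _}) z).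
rewrite -[RHS]/((f \o ev K : {linear _ -> _}) z).
apply: tens_ext => h c.
rewrite -[LHS]/(ev K' (tens_map (hom_post C f) idfun (pure h c))) tens_mapE.
by rewrite -[RHS]/(f (ev K (pure h c))) !evE.
Qed.

Hypothesis coevb : forall F, flat F -> bijective (coev C F).

(** Transporting the coevaluation of F along K = F (x) C identifies F with
Hom(C, K), and under this identification the evaluation of K becomes the given
isomorphism F (x) C -> K. *)
Lemma F_class_coev (K : lmodType R) : F_class C K ->
  exists (F : lmodType R) (p : {linear F -> hom C K})
         (i : {linear hom C K -> F}),
    [/\ flat F, cancel i p, cancel p i & bijective (ev K)].
Proof.
case=> F [Ff] /isomorphicP[a [b [aK bK]]].
have [coevi [coevK coeviK]] := bij_linear_inv (coevb Ff).
pose p : {linear F -> hom C K} := hom_post C b \o coev C F.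
pose i : {linear hom C K -> F} := coevi \o hom_post C a.
have iK : cancel i p.
  move=> h.
  rewrite -[LHS]/(hom_post C b (coev C F (coevi (hom_post C a h)))) coeviK.
  by apply: linear_eqP => c; apply: aK.
have pK : cancel p i.
  move=> x; rewrite -[RHS]coevK; congr (coevi _).
  by apply: linear_eqP => c; apply: bK.
exists F, p, i; split=> //.
have evp z : ev K (tens_map p idfun z) = b z.
  rewrite -[LHS]/((ev K \o tens_map p idfun : {linear _ -> _}) z).
  apply: tens_ext => x c.
  by rewrite -[LHS]/(ev K (tens_map p idfun (pure x c))) tens_mapE evE.
exists (tens_map p idfun \o a) => [z|x]; last first.
  by rewrite -[LHS]/(ev K (tens_map p idfun (a x))) evp aK.
have ipK : cancel (tens_map i (idfun : {linear C -> C})) (tens_map p idfun).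
  exact: tens_mapK.
rewrite -[RHS]ipK -{1}[z]ipK evp.
by rewrite -[LHS]/(tens_map p idfun (a (b (tens_map i idfun z)))) bK.
Qed.

Lemma F_class_hom_flat (K : lmodType R) : F_class C K -> flat (hom C K).
Proof.
by case/F_class_coev => F [p [i [Ff iK _ _]]]; apply: flat_retract iK Ff.
Qed.

Lemma F_class_ev_bij (K : lmodType R) : F_class C K -> bijective (ev K).
Proof. by case/F_class_coev => F [p [i []]]. Qed.

End Evaluation.

(** * Exact complexes of flat modules *)

Section FlatComplexes.
Variable R : comPzRingType.

Lemma exact_transfer (X Y : chain_complex R) (u : chain_map X Y) :
  (forall n, bijective (u n)) -> exact_complex X -> exact_complex Y.
Proof.
move=> ub Xex n y dy; have [v uK vK] := ub n.
have [z dz] : exists z, diff X n z = v y.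
  apply: Xex; case: n y dy v uK vK => [|n] //= y dy v uK vK.
  by apply: (bij_inj (ub n)); rewrite cmap_diff vK dy linear0.
by exists (u n.+1 z); rewrite -cmap_diff dz vK.
Qed.

Lemma tens_diff_out (X : chain_complex R) (N : lmodType R) n z :
  diff_out (tens_complex X N) n z = tens_map (diff_out X n) idfun z.
Proof. by case: n z => [|n] z //; rewrite [RHS]tens_map0l. Qed.

Lemma tensor_unit_natural (A B : lmodType R) (f : {linear A -> B}) z :
  tensor_unit B (tens_map f idfun z) = f (tensor_unit A z).
Proof.
rewrite -[LHS]/((tensor_unit B \o tens_map f idfun : {linear _ -> _}) z).
rewrite -[RHS]/((f \o tensor_unit A : {linear _ -> _}) z).
apply: tens_ext => a r.
rewrite -[LHS]/(tensor_unit B (tens_map f idfun (pure a r))) tens_mapE.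
by rewrite -[RHS]/(f (tensor_unit A (pure a r))) !tensor_unitE linearZ.
Qed.

Lemma exact_tens_unit (X : chain_complex R) :
  exact_complex X -> exact_complex (tens_complex X R^o).
Proof.
move=> Xex n z; rewrite tens_diff_out => dz.
have [|y yz] := Xex n (tensor_unit (X n) z).
  by rewrite -tensor_unit_natural dz linear0.
exists (pure y (1 : R^o)).
by rewrite [LHS]tens_mapE yz tensor_unitK.
Qed.

Lemma exact_tens_pow (X : chain_complex R) (U : lmodType R) m :
  exact_complex (tens_complex X U) ->
  exact_complex (tens_complex X ({ffun 'I_m -> U} : lmodType R)).
Proof.
move=> Xex n z; rewrite tens_diff_out => dz.
have cyc k : exists y, tens_map (diff X n) idfun y =
                       tens_map idfun (pow_proj U k) z.
  apply: Xex; rewrite tens_diff_out.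
  transitivity
    (tens_map idfun (pow_proj U k) (tens_map (diff_out X n) idfun z)).
    exact: tens_map_square.
  by rewrite dz linear0.
pose y k := projT1 (cid (cyc k)).
have yE k : tens_map (diff X n) idfun (y k) = tens_map idfun (pow_proj U k) z.
  exact: projT2 (cid (cyc k)).
exists (\sum_k tens_map idfun (pow_inj U k) (y k)).
rewrite [LHS]linear_sum [RHS]tensor_pow_sum; apply: eq_bigr => k _.
rewrite -yE; exact: tens_map_square.
Qed.

Fact lincomb_linear m (U : lmodType R) (x : 'I_m -> U) :
  linear (fun a : {ffun 'I_m -> R^o} => \sum_k (a k : R) *: x k).
Proof.
move=> r a b; rewrite scaler_sumr -big_split; apply: eq_bigr => k _.
by rewrite !ffunE scalerDl -scalerA.
Qed.
Definition lincomb m (U : lmodType R) (x : 'I_m -> U) :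
  {linear {ffun 'I_m -> R^o} -> U} := mk_linear (lincomb_linear x).

Lemma lincombE m (U : lmodType R) (x : 'I_m -> U) k :
  lincomb x (pow_inj R^o k (1 : R^o)) = x k.
Proof.
rewrite /= (bigD1 k) //= ffunE eqxx scale1r big1 ?addr0 // => i /negPf ik.
by rewrite ffunE ik scale0r.
Qed.

(** An element of A (x) U involves only finitely many elements of U; they are
the images of the basis of a finite free module. *)
Lemma tensor_finite_support (A U : lmodType R) (z : tensor A U) :
  exists m (x : 'I_m -> U) (z' : tensor A {ffun 'I_m -> R^o}),
    tens_map idfun (lincomb x) z' = z.
Proof.
have [s ->] := tensor_sum z.
exists (size s), (fun k => (tnth (in_tuple s) k).2).
exists (\sum_k pure (tnth (in_tuple s) k).1 (pow_inj R^o k (1 : R^o))).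
rewrite [LHS]linear_sum [RHS]big_tnth; apply: eq_bigr => k _.
by rewrite tens_mapE lincombE.
Qed.

(** Dimension shifting, for all N at once, by induction on the degree.  Let z be
a cycle of degree n+1, lifted to z' with coefficients in a finite free module
with a map p to N, and let Y be the kernel of p.  As X n is flat, the boundary
of z' comes from a chain y of degree n with coefficients in Y, and y is a cycle
because X (n-1) is flat.  By induction y is the boundary of some w, so
z' - w is a cycle with free coefficients, hence a boundary; and it has the same
image z as z'. *)
Proposition exact_flat_tens (X : chain_complex R) (N : lmodType R) :
  (forall n, flat (X n)) -> exact_complex X -> exact_complex (tens_complex X N).
Proof.
move=> Xf Xex n; elim: n N => [|n IHn] N z; rewrite tens_diff_out => dz;
  have [m [x [z' z'E]]] := tensor_finite_support z;
  have free_ex := exact_tens_pow (m := m) (exact_tens_unit Xex).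
  (* In degree 0 there is no cycle condition to lift. *)
  have [|y yz] := free_ex 0 z'; first by rewrite tens_diff_out tens_map0l.
  exists (tens_map idfun (lincomb x) y); rewrite -z'E -yz.
  exact: tens_map_square.
pose p := lincomb x; pose Y : lmodType R := ker p.
have val_lin : linear (val : Y -> _) by move=> a u v; rewrite linearP.
pose iota : {linear Y -> {ffun 'I_m -> R^o}} := mk_linear val_lin.
have p_iota y : p (iota y) = 0 by case: y => y /= /eqP.
have iota_p b : p b = 0 -> exists y, iota y = b.
  by move=> /eqP pb; exists (Ker pb).
have iota_inj : injective iota by apply: val_inj.
have [|y yz] := flat_exact (z := tens_map (diff X n) idfun z')
  (Xf n) p_iota iota_p.
  by rewrite -[RHS]dz -z'E; apply: tens_map_square.
have [|w wy] := IHn Y y.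
  rewrite tens_diff_out; apply: (Xf _ _ _ iota iota_inj); rewrite linear0.
  transitivity (tens_map (diff_out X n) idfun (tens_map idfun iota y)).
    exact: tens_map_square.
  by rewrite yz -!tens_diff_out; apply: (@diff_outK _ (tens_complex X _)).
have [|v vz] := free_ex n.+1 (z' - tens_map idfun iota w).
  rewrite linearB; apply/eqP; rewrite subr_eq0; apply/eqP.
  rewrite -[LHS]/(tens_map (diff X n) idfun z') -yz -wy.
  exact: tens_map_square.
exists (tens_map idfun p v).
transitivity (tens_map idfun p (tens_map (diff X n.+1) idfun v)).
  exact: tens_map_square.
rewrite [X in tens_map idfun p X]vz linearB z'E -[RHS]subr0; congr (_ - _).
rewrite -(tens_map0r _ (idfun : {linear X n.+1 -> X n.+1}) w).
exact: tens_map_compE.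
Qed.

End FlatComplexes.

(** * Complexes of modules in F_C *)

Section EvaluationComplex.
Variables (R : comPzRingType) (C : lmodType R).
Hypothesis coevb : forall F, flat F -> bijective (coev C F).

Variables (X : chain_complex R) (N : lmodType R).

Let hom_tens n : {linear tensor (hom C (X n)) (tensor C N) -> tensor (X n) N} :=
  tens_map (ev C (X n)) idfun \o assoc _ _ _.

Fact hom_tens_diff n z :
  hom_tens n (diff (tens_complex (hom_from C X) (tensor C N)) n z) =
  diff (tens_complex X N) n (hom_tens n.+1 z).
Proof.
rewrite -[LHS]/(tens_map (ev C (X n)) idfun (assoc _ _ _
                  (tens_map (hom_post C (diff X n)) idfun z))).
rewrite assoc_natural; apply: tens_map_square => // y.
exact: ev_natural.
Qed.

Let hom_tens_map :
    chain_map (tens_complex (hom_from C X) (tensor C N)) (tens_complex X N) :=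
  @ChainMap R (tens_complex (hom_from C X) (tensor C N)) (tens_complex X N)
    hom_tens hom_tens_diff.

(** Evaluation and associativity identify X (x) N with
Hom(C, X) (x) (C (x) N), and Hom(C, X) is an exact complex of flat modules. *)
Proposition exact_F_class_tens : (forall n, F_class C (X n)) ->
  exact_complex (hom_from C X) -> exact_complex (tens_complex X N).
Proof.
move=> Xc Xex; apply: (exact_transfer (u := hom_tens_map)) => [n|].
  apply: bij_comp; last first.
    by exists (assoc_inv _ _ _); [apply: assocK | apply: assoc_invK].
  have [g [gK Kg]] := bij_linear_inv (F_class_ev_bij coevb (Xc n)).
  by exists (tens_map g idfun); apply: tens_mapK.
apply: exact_flat_tens => // n; exact: F_class_hom_flat.
Qed.

End EvaluationComplex.

(** * Homology classes and homotopies *)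

Section Homology.
Variable R : comPzRingType.

Definition hclass (X : chain_complex R) n (x : X n) (dx : diff_out X n x = 0) :
    homology X n :=
  coker_proj (corestr (diff_outK (X := X) (n := n)))
    (Ker (introT eqP dx : x \in in_ker (diff_out X n))).

Lemma hclassP (X : chain_complex R) n (h : homology X n) :
  exists x (dx : diff_out X n x = 0), h = hclass dx.
Proof.
have [[x xk] <-] := coker_proj_surj h.
exists x, (eqP xk); congr (coker_proj _ _); exact: val_inj.
Qed.

Lemma hclass_eq0 (X : chain_complex R) n (x : X n) (dx : diff_out X n x = 0) :
  hclass dx = 0 <-> exists w, diff X n w = x.
Proof.
rewrite coker_projP; split=> -[w e]; exists w; first exact: (congr1 val e).
exact: val_inj.
Qed.

Lemma hclass_eq (X : chain_complex R) n (x y : X n)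
    (dx : diff_out X n x = 0) (dy : diff_out X n y = 0) w :
  diff X n w = x - y -> hclass dx = hclass dy.
Proof.
move=> e; apply/eqP; rewrite -subr_eq0 -linearB; apply/eqP/coker_projP.
by exists w; apply: val_inj; apply: e.
Qed.

Lemma homology_mapE (X Y : chain_complex R) (u : chain_map X Y) n (x : X n)
    (dx : diff_out X n x = 0) (dux : diff_out Y n (u n x) = 0) :
  homology_map u n (hclass dx) = hclass dux.
Proof.
rewrite /homology_map coker_liftE.
by congr (coker_proj _ _); apply: val_inj.
Qed.

Lemma cmap_cycle (X Y : chain_complex R) (u : chain_map X Y) n (x : X n) :
  diff_out X n x = 0 -> diff_out Y n (u n x) = 0.
Proof. by case: n x => [|n] x //= e; rewrite -cmap_diff e linear0. Qed.

Arguments homology_mapE [X Y] u [n x] dx dux.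
Arguments cmap_cycle [X Y] u [n x] _.

Lemma eq_homology_map (X Y : chain_complex R) (u v : chain_map X Y) n h :
  (forall m x, u m x = v m x) -> homology_map u n h = homology_map v n h.
Proof.
move=> uv; have [x [dx ->]] := hclassP h.
rewrite (homology_mapE u dx (cmap_cycle u dx)).
rewrite (homology_mapE v dx (cmap_cycle v dx)).
by apply: (@hclass_eq _ _ _ _ _ _ 0); rewrite linear0 uv subrr.
Qed.

Definition comp_chain_map (X Y Z : chain_complex R) (v : chain_map Y Z)
    (u : chain_map X Y) : chain_map X Z.
Proof.
exists (fun n => v n \o u n) => n x.
by rewrite /= !cmap_diff.
Defined.

Lemma homology_map_comp (X Y Z : chain_complex R) (v : chain_map Y Z)
    (u : chain_map X Y) n h :
  homology_map (comp_chain_map v u) n h = homology_map v n (homology_map u n h).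
Proof.
have [x [dx ->]] := hclassP h.
rewrite (homology_mapE u dx (cmap_cycle u dx)).
rewrite (homology_mapE v _ (cmap_cycle v (cmap_cycle u dx))).
exact: homology_mapE.
Qed.

Definition homotopic (X Y : chain_complex R) (u v : chain_map X Y) :=
  exists s : forall n, {linear X n -> Y n.+1},
    (forall x, u 0 x - v 0 x = diff Y 0 (s 0 x)) /\
    (forall n x, u n.+1 x - v n.+1 x =
                 diff Y n.+1 (s n.+1 x) + s n (diff X n x)).

Lemma homotopic_homology (X Y : chain_complex R) (u v : chain_map X Y) n h :
  homotopic u v -> homology_map u n h = homology_map v n h.
Proof.
move=> [s [s0 s1]]; have [x [dx ->]] := hclassP h.
rewrite (homology_mapE u dx (cmap_cycle u dx)).
rewrite (homology_mapE v dx (cmap_cycle v dx)).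
apply: (@hclass_eq _ _ _ _ _ _ (s n x)).
by case: n h x dx => [|n] h x /= dx; rewrite ?s0 ?s1 // dx linear0 addr0.
Qed.

Lemma homotopic_tens (X Y : chain_complex R) (N N' : lmodType R)
    (g : {linear N -> N'}) (u v : chain_map X Y) :
  homotopic u v -> homotopic (tens_chain_map u g) (tens_chain_map v g).
Proof.
move=> [s [s0 s1]]; exists (fun n => tens_map (s n) g).
split=> [z|n z].
  rewrite -[LHS]/(tens_map (u 0) g z - tens_map (v 0) g z) -tens_map_subl.
  by symmetry; apply: tens_map_compE => // x; rewrite -s0.
rewrite -[LHS]/(tens_map (u n.+1) g z - tens_map (v n.+1) g z) -tens_map_subl.
rewrite -[RHS]/(tens_map (diff Y n.+1) idfun (tens_map (s n.+1) g z) +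
                tens_map (s n) g (tens_map (diff X n) idfun z)).
pose dX := s n \o diff X n : {linear X n.+1 -> Y n.+1}.
have -> : tens_map (s n) g (tens_map (diff X n) idfun z) =
          tens_map dX (idfun \o g : {linear _ -> _}) z.
  exact: tens_map_compE.
rewrite tens_map_comp -tens_map_addl; apply: eq_tens_map => // x.
exact: s1.
Qed.

End Homology.
Arguments homology_mapE [R X Y] u [n x] dx dux.
Arguments cmap_cycle [R X Y] u [n x] _.

(** * Mapping cones *)

(** The terms are X (n-1) + Y n.  The sign sits on the differential of Y
instead of that of X, which gives an isomorphic complex and keeps the first
component a plain chain of X. *)
Section MappingCone.
Variables (R : comPzRingType) (X Y : chain_complex R) (u : chain_map X Y).

Definition cone_obj n : lmodType R :=
  if n is m.+1 then (X m * Y m.+1)%type else Y 0.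

Definition cone_diff_fun n : cone_obj n.+1 -> cone_obj n :=
  match n return cone_obj n.+1 -> cone_obj n with
  | 0 => fun z => u 0 z.1 - diff Y 0 z.2
  | m.+1 => fun z => (diff X m z.1, u m.+1 z.1 - diff Y m.+1 z.2)
  end.

Fact cone_diff_linear n : linear (@cone_diff_fun n).
Proof.
have lin m a (z w : (X m * Y m.+1)%type) :
    u m (a *: z + w).1 - diff Y m (a *: z + w).2 =
    a *: (u m z.1 - diff Y m z.2) + (u m w.1 - diff Y m w.2).
  rewrite -[LHS]/(u m (a *: z.1 + w.1) - diff Y m (a *: z.2 + w.2)).
  by rewrite (linearP (u m)) (linearP (diff Y m)) opprD scalerBr addrACA.
case: n => [|n] a z w; first exact: lin.
congr pair; last exact: lin.
exact: linearP.
Qed.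
Definition cone_diff n : {linear cone_obj n.+1 -> cone_obj n} :=
  mk_linear (@cone_diff_linear n).

Fact cone_diffK n z : cone_diff n (cone_diff n.+1 z) = 0.
Proof.
case: n z => [|n] [x y] /=.
  by rewrite linearB cmap_diff diffK subr0 subrr.
by congr pair; rewrite ?diffK // linearB cmap_diff diffK subr0 subrr.
Qed.

Definition cone : chain_complex R :=
  {| obj := cone_obj; diff := cone_diff; diffK := cone_diffK |}.

Lemma exact_cone_homology_bij n :
  exact_complex cone -> bijective (homology_map u n).
Proof.
move=> ex; apply: inj_surj_bij.
  apply: lin_inj => h; have [x [dx ->]] := hclassP h.
  rewrite (homology_mapE u dx (cmap_cycle u dx)) => /hclass_eq0[w dw].
  have [|[x' w'] e] := ex n.+1 ((x, w) : cone n.+1).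
    case: n {h} x dx w dw => [|n] x dx w dw; rewrite /= -dw ?subrr //.
    by congr pair; rewrite ?subrr.
  apply/hclass_eq0; exists x'.
  by case: n {h} x dx w dw x' w' e => [|n] x dx w dw x' w' [].
move=> h; have [y [dy ->]] := hclassP h.
suff [x [dx [w e]]] : exists x, diff_out X n x = 0 /\
    exists w, diff Y n w = u n x - y.
  exists (hclass dx); rewrite (homology_mapE u dx (cmap_cycle u dx)).
  exact: hclass_eq e.
case: n y {h} dy => [|n] y dy.
  have [//|[x w] e] := ex 0 (y : cone 0).
  exists x; split=> //; exists w; rewrite -e /= opprB addrC subrK.
  by [].
have [|[x w] [e1 e2]] := ex n.+1 ((0, y) : cone n.+1).
  case: n y dy => [|n] y /= dy; rewrite ?linear0 dy subrr //.
exists x; split=> //; exists w; rewrite -e2 /= opprB addrC subrK.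
by [].
Qed.

End MappingCone.

(** Tensoring commutes with finite direct sums, hence with cones. *)
Section TensorCone.
Variables (R : comPzRingType) (X Y : chain_complex R) (u : chain_map X Y).
Variable N : lmodType R.

Let tu := tens_chain_map u (idfun : {linear N -> N}).

Fact split_cone_linear m :
  linear (fun z : tensor (X m * Y m.+1)%type N =>
    (tens_map (fst : {linear (X m * Y m.+1)%type -> X m}) idfun z,
     tens_map (snd : {linear (X m * Y m.+1)%type -> Y m.+1}) idfun z)
    : (tensor (X m) N * tensor (Y m.+1) N)%type).
Proof. by move=> a z w; congr pair; apply: linearP. Qed.

Definition split_cone n : {linear tens_complex (cone u) N n -> cone tu n} :=
  match n with
  | 0 => idfun
  | m.+1 => mk_linear (@split_cone_linear m)
  end.

Lemma split_cone_bij n : bijective (split_cone n).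
Proof.
case: n => [|n]; first by exists id.
exists (fun p => tens_map (pair_l (X n) (Y n.+1)) idfun p.1 +
                 tens_map (pair_r (X n) (Y n.+1)) idfun p.2) => [z|[a b]].
  by symmetry; apply: tensor_pairE.
congr pair; rewrite linearD.
  rewrite -[RHS]addr0; congr (_ + _).
    by rewrite -[RHS]tens_map_id; apply: tens_map_compE.
  by rewrite -(tens_map0l (X n) idfun b); apply: tens_map_compE.
rewrite -[RHS]add0r; congr (_ + _).
  by rewrite -(tens_map0l (Y n.+1) idfun a); apply: tens_map_compE.
by rewrite -[RHS]tens_map_id; apply: tens_map_compE.
Qed.

Fact split_cone_diff n z :
  split_cone n (diff (tens_complex (cone u) N) n z) =
  diff (cone tu) n (split_cone n.+1 z).
Proof.
have sub m (f : {linear (X m * Y m.+1)%type -> Y m})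
    (w : tensor (X m * Y m.+1)%type N) :
    (forall p, f p = u m p.1 - diff Y m p.2) ->
    tens_map f idfun w =
    tens_map (u m) idfun (tens_map (fst : {linear _ -> _}) idfun w) -
    tens_map (diff Y m) idfun (tens_map (snd : {linear _ -> _}) idfun w).
  move=> fE; rewrite !tens_map_comp -tens_map_subl.
  by apply: eq_tens_map => // p; apply: fE.
case: n z => [|n] z; first exact: sub.
congr pair; first exact: tens_map_square.
rewrite [LHS](tens_map_comp (snd : {linear (X n * Y n.+1)%type -> Y n.+1})).
exact: sub.
Qed.

Definition split_cone_map : chain_map (tens_complex (cone u) N) (cone tu) :=
  @ChainMap R (tens_complex (cone u) N) (cone tu) split_cone split_cone_diff.

Lemma exact_cone_tens_bij n : exact_complex (tens_complex (cone u) N) ->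
  bijective (homology_map tu n).
Proof.
move=> ex; apply: exact_cone_homology_bij.
exact: (exact_transfer (u := split_cone_map)) split_cone_bij ex.
Qed.

End TensorCone.

(** * Comparison of resolutions *)

Lemma exact_hom_lift (R : comPzRingType) (Z : lmodType R)
    (Y : chain_complex R) n (h : {linear Z -> Y n}) :
  exact_complex (hom_from Z Y) -> (forall z, diff_out Y n (h z) = 0) ->
  exists k : {linear Z -> Y n.+1}, forall z, diff Y n (k z) = h z.
Proof.
move=> ex dh; have [|k kE] := ex n (h : hom Z (Y n)).
  by apply: linear_eqP => z; case: n h dh => [|n] h dh //; apply: dh.
by exists (k : {linear Z -> Y n.+1}) => z; rewrite -kE.
Qed.

Section Comparison.
Variables (R : comPzRingType) (X Y : chain_complex R) (M M' : lmodType R).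
Variables (epsX : {linear X 0 -> M}) (epsY : {linear Y 0 -> M'}).
Hypotheses (epsXK : forall x, epsX (diff X 0 x) = 0).
Hypotheses (epsYK : forall y, epsY (diff Y 0 y) = 0).
Hypothesis Yexact : forall n, exact_complex (hom_from (X n) (augmented epsYK)).

Let X' := augmented epsXK.
Let Y' := augmented epsYK.

Let lift_cycle n m (h : {linear X m -> Y' n}) :
  (forall x, diff_out Y' n (h x) = 0) ->
  {k : {linear X m -> Y' n.+1} | forall x, diff Y' n (k x) = h x}.
Proof. by move=> dh; apply/cid/exact_hom_lift. Qed.

Section Existence.
Variable f : {linear M -> M'}.

(* The recursion runs over the augmented complexes and starts with f in degree
   0, that is, in degree -1 of the resolutions.  Each stage records that the
   composite with the next differential is a cycle, which is what the following
   lifting step requires. *)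
Let partial n := {h : {linear X' n -> Y' n} |
  forall x, diff_out Y' n (h (diff X' n x)) = 0}.

Let next n (h : partial n) : {k : partial n.+1 |
  forall x, diff Y' n (sval k x) = sval h (diff X' n x)}.
Proof.
case: h => h hc; have [k kE] := lift_cycle
  (h := h \o diff X' n : {linear X n -> Y' n}) hc.
have kc x : diff_out Y' n.+1 (k (diff X' n.+1 x)) = 0.
  by rewrite [LHS]kE -[LHS]/(h (diff X' n (diff X' n.+1 x))) diffK linear0.
by exists (exist _ k kc).
Qed.

Lemma comparison_exists :
  exists u : chain_map X Y, forall x, epsY (u 0 x) = f (epsX x).
Proof.
have fc x : diff_out Y' 0 (f (diff X' 0 x)) = 0 by [].
pose s := nat_rect partial (exist _ f fc) (fun n h => sval (next h)).
have sE n x : diff Y' n (sval (s n.+1) x) = sval (s n) (diff X' n x).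
  exact: (svalP (next (s n))).
pose u n : {linear X n -> Y n} := sval (s n.+1).
have uE n x : u n (diff X n x) = diff Y n (u n.+1 x).
  by symmetry; apply: (sE n.+1).
by exists (ChainMap uE) => x; apply: (sE 0).
Qed.

End Existence.

Section Uniqueness.
Variables u v : chain_map X Y.
Hypothesis uv : forall x, epsY (u 0 x) = epsY (v 0 x).

Let w n : {linear X n -> Y n} := u n \- v n.

Let wE n x : w n x = u n x - v n x. Proof. by []. Qed.

Let w_diff n x : w n (diff X n x) = diff Y n (w n.+1 x).
Proof. by rewrite !wE linearB !cmap_diff. Qed.

(* In degree 0 the lifting problem is solved in degree 1 of the augmented
   complex, where cycles are the elements killed by epsY. *)
Let homotopy0 :
  {s : {linear X 0 -> Y 1%N} | forall x, diff Y 0 (s x) = w 0 x}.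
Proof.
have [|s sE] := @lift_cycle 1%N 0 (w 0); last by exists s.
by move=> x; rewrite -[LHS]/(epsY (w 0 x)) wE linearB uv subrr.
Qed.

Let partial n := {s : {linear X n -> Y n.+1} |
  forall x, diff Y n (s (diff X n x)) = diff Y n (w n.+1 x)}.

Let homotopy_next n (s : partial n) : {t : partial n.+1 |
  forall x, diff Y n.+1 (sval t x) = w n.+1 x - sval s (diff X n x)}.
Proof.
case: s => s sE.
pose h : {linear X n.+1 -> Y n.+1} := w n.+1 \- (s \o diff X n).
have hE x : h x = w n.+1 x - s (diff X n x) by [].
have [|t tE] := @lift_cycle n.+2 n.+1 h.
  by move=> x; rewrite -[LHS]/(diff Y n (h x)) hE linearB sE subrr.
have tc x : diff Y n.+1 (t (diff X n.+1 x)) = diff Y n.+1 (w n.+2 x).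
  by rewrite [LHS]tE hE diffK linear0 subr0 w_diff.
by exists (exist _ t tc).
Qed.

Lemma comparison_homotopic : homotopic u v.
Proof.
have [s0 s0E] := homotopy0.
have s0c x : diff Y 0 (s0 (diff X 0 x)) = diff Y 0 (w 1 x).
  by rewrite s0E w_diff.
pose s := nat_rect partial (exist _ s0 s0c) (fun n h => sval (homotopy_next h)).
exists (fun n => sval (s n)); split=> [x|n x]; first by rewrite s0E.
by rewrite [X in _ = X + _](svalP (homotopy_next (s n))) subrK.
Qed.

End Uniqueness.
End Comparison.

Section Pairing.
Variables (R : comPzRingType) (Z U V : lmodType R).
Variables (f : {linear Z -> U}) (g : {linear Z -> V}).
Fact pair_map_linear : linear (fun z => (f z, g z) : (U * V)%type).
Proof. by move=> a x y; congr pair; apply: linearP. Qed.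
Definition pair_map : {linear Z -> (U * V)%type} := mk_linear pair_map_linear.
End Pairing.

Section ConeOfComparison.
Variables (R : comPzRingType) (X Y : chain_complex R) (M : lmodType R).
Variables (epsX : {linear X 0 -> M}) (epsY : {linear Y 0 -> M}).
Hypotheses (epsXK : forall x, epsX (diff X 0 x) = 0).
Hypotheses (epsYK : forall y, epsY (diff Y 0 y) = 0).
Variable u : chain_map X Y.
Hypothesis u_eps : forall x, epsY (u 0 x) = epsX x.

(** The cone of a map between resolutions of the same M is the quotient of the
cone of the augmented map by the contractible cone of the identity of M; the
elementwise proof lifts first through the resolution X, then through Y. *)
Lemma exact_cone_hom_from (C : lmodType R) :
  exact_complex (hom_from C (augmented epsXK)) ->
  exact_complex (hom_from C (augmented epsYK)) ->
  exact_complex (hom_from C (cone u)).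
Proof.
move=> Xex Yex.
move=> [|m] /= f df.
  have [//|k kE] := exact_hom_lift (n := 0)
    (h := epsY \o hom_fun f : {linear C -> augmented epsXK 0}) Xex.
  pose h : {linear C -> Y 0} := (u 0 \o k) \- hom_fun f.
  have [|g gE] := exact_hom_lift (Y := augmented epsYK) (n := 1) (h := h) Yex.
    move=> c; rewrite -[LHS]/(epsY (u 0 (k c) - hom_fun f c)) linearB u_eps.
    by rewrite [X in X - _]kE subrr.
  exists (pair_map k g : {linear C -> cone u 1%N}); apply: linear_eqP => c.
  rewrite -[LHS]/(u 0 (k c) - diff Y 0 (g c)) [X in _ - X]gE.
  by rewrite -[h c]/(u 0 (k c) - hom_fun f c) opprB addrC subrK.
have dfc c := congr1 (fun h : hom C _ => hom_fun h c) df.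
pose f1 : {linear C -> X m} := (fst : {linear _ -> _}) \o hom_fun f.
pose f2 : {linear C -> Y m.+1} := (snd : {linear _ -> _}) \o hom_fun f.
have uf c : u m (f1 c) = diff Y m (f2 c).
  apply/eqP; rewrite -subr_eq0; apply/eqP.
  case: m f df dfc @f1 @f2 => [|m] f df dfc f1 f2; first exact: dfc.
  by have [_] := dfc c.
have [c|a aE] :=
    exact_hom_lift (Y := augmented epsXK) (n := m.+1) (h := f1) Xex.
  case: m f df dfc @f1 @f2 uf => [|m] f df dfc f1 f2 uf.
    by rewrite -[LHS]/(epsX (f1 c)) -u_eps uf epsYK.
  by have [] := dfc c.
pose h : {linear C -> Y m.+1} := (u m.+1 \o a) \- f2.
have [c|b bE] :=
    exact_hom_lift (Y := augmented epsYK) (n := m.+2) (h := h) Yex.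
  rewrite -[LHS]/(diff Y m (u m.+1 (a c) - f2 c)) linearB -cmap_diff.
  by rewrite [X in u m X]aE uf subrr.
exists (pair_map a b : {linear C -> cone u m.+2}); apply: linear_eqP => c.
transitivity (f1 c, f2 c); last by rewrite /=; case: (hom_fun f c).
congr pair; first exact: aE.
rewrite -[LHS]/(u m.+1 (a c) - diff Y m.+1 (b c)) [X in _ - X]bE.
by rewrite -[h c]/(u m.+1 (a c) - f2 c) opprB addrC subrK.
Qed.

End ConeOfComparison.

(** * The classes P_C and F_C *)

Section ClassClosure.
Variables (R : comPzRingType) (C : lmodType R).

Lemma P_class_F_class (K : lmodType R) : P_class C K -> F_class C K.
Proof. by case=> P [Pp iso]; exists P; split=> //; apply: projective_flat. Qed.

Lemma unit_projective : projective (R^o : lmodType R).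
Proof.
move=> A B e f e_surj; have [a ea] := e_surj (f (1 : R^o)).
have lin : linear (fun r : R^o => (r : R) *: a).
  by move=> x r s; rewrite scalerDl scalerA.
exists (mk_linear lin) => r.
rewrite -[LHS]/(e ((r : R) *: a)) linearZ ea -linearZ /=.
by congr (f _); apply: mulr1.
Qed.

Lemma P_class_self : P_class C C.
Proof.
exists R^o; split; first exact: unit_projective.
have lin : linear (pure_r C (1 : R^o)) by apply: linearP.
exists (pure_r C (1 : R^o)).
have hl (c : C) : linear (fun r : R^o => (r : R) *: c).
  by move=> x r s; rewrite scalerDl scalerA.
have hr (r : R^o) : linear (fun c : C => (r : R) *: c).
  by move=> x c d; rewrite scalerDr !scalerA mulrC.
exists (tens_lift hl hr) => [c|z]; first by rewrite [LHS]tens_liftE scale1r.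
rewrite -[RHS]/((idfun : {linear _ -> _}) z).
rewrite -[LHS]/((pure_r C (1 : R^o) \o tens_lift hl hr : {linear _ -> _}) z).
apply: tens_ext => r c.
rewrite -[LHS]/(pure (1 : R^o) (tens_lift hl hr (pure r c))) tens_liftE.
by rewrite pureZr -pureZl; congr pure; apply: mulr1.
Qed.

Lemma F_class_prod (K L : lmodType R) :
  F_class C K -> F_class C L -> F_class C (K * L)%type.
Proof.
move=> [F [Ff /isomorphicP[a [a' [aK a'K]]]]].
move=> [G [Gf /isomorphicP[b [b' [bK b'K]]]]].
exists (F * G)%type; split; first exact: flat_prod.
pose f : {linear tensor (F * G)%type C -> (K * L)%type} := pair_map
  (a' \o tens_map (fst : {linear _ -> _}) idfun)
  (b' \o tens_map (snd : {linear _ -> _}) idfun).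
pose g : {linear (K * L)%type -> tensor (F * G)%type C} :=
  (tens_map (pair_l F G) idfun \o (a \o (fst : {linear _ -> _}))) \+
  (tens_map (pair_r F G) idfun \o (b \o (snd : {linear _ -> _}))).
have gE p : g p = tens_map (pair_l F G) idfun (a p.1) +
                  tens_map (pair_r F G) idfun (b p.2) by [].
exists g, f => [[k l]|z]; last first.
  by rewrite gE /f /= a'K b'K; symmetry; apply: tensor_pairE.
congr pair; rewrite gE.
  transitivity (a' (a k + 0)); last by rewrite addr0 aK.
  congr (a' _); rewrite linearD; congr (_ + _).
    by rewrite -[RHS]tens_map_id; apply: tens_map_compE.
  by rewrite -(tens_map0l F idfun (b l)); apply: tens_map_compE.
transitivity (b' (0 + b l)); last by rewrite add0r bK.
congr (b' _); rewrite linearD; congr (_ + _).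
  by rewrite -(tens_map0l G idfun (a k)); apply: tens_map_compE.
by rewrite -[RHS]tens_map_id; apply: tens_map_compE.
Qed.

End ClassClosure.

(** * Relative Tor *)

Section ComparisonOfResolutions.
Variables (R : comPzRingType) (C : lmodType R).

Lemma semidualizing_coev_bij : noetherian R -> semidualizing C ->
  forall F, flat F -> bijective (coev C F).
Proof.
move=> noethR [fgC homothety_bij _] F Ff.
have [n [m [g [rho presC]]]] := noetherian_presentation noethR fgC.
exact: coev_bij presC homothety_bij _ Ff.
Qed.

Lemma proper_on_P_class (M M' : lmodType R)
    (Q : proper_resolution (P_class C) M)
    (G : proper_resolution (F_class C) M') n :
  exact_complex (hom_from (Q n) (augmented (augK (p := G)))).
Proof. exact: res_proper (P_class_F_class (res_class Q n)). Qed.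

(** The cone of u has terms in F_C and is Hom(C, -)-exact, C being a member of
both classes; hence it stays exact after tensoring with N. *)
Lemma tens_comparison_bij (M N : lmodType R)
    (Q : proper_resolution (P_class C) M)
    (G : proper_resolution (F_class C) M) (u : chain_map Q G) i :
  (forall F, flat F -> bijective (coev C F)) ->
  (forall x, aug G (u 0 x) = aug Q x) ->
  bijective (homology_map (tens_chain_map u (idfun : {linear N -> N})) i).
Proof.
move=> coevb u_aug; apply: exact_cone_tens_bij.
apply: (exact_F_class_tens coevb) => [[|n]|].
- exact: res_class.
- have Qn := P_class_F_class (res_class Q n).
  exact: F_class_prod Qn (res_class G n.+1).
have Cproj := P_class_self C; have Cflat := P_class_F_class Cproj.
exact: (exact_cone_hom_from u_aug) (res_proper Cproj) (res_proper Cflat).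
Qed.

End ComparisonOfResolutions.

Theorem theorem1 (R : comPzRingType) (C : lmodType R) :
  noetherian R -> semidualizing C ->
  forall i : nat,
  exists phi : forall (M N : lmodType R)
                 (Q : proper_resolution (P_class C) M)
                 (G : proper_resolution (F_class C) M),
               {linear relTor Q N i -> relTor G N i},
    (forall (M N : lmodType R)
            (Q : proper_resolution (P_class C) M)
            (G : proper_resolution (F_class C) M),
        bijective (phi M N Q G)) /\
    (forall (M M' N N' : lmodType R)
            (f : {linear M -> M'}) (g : {linear N -> N'})
            (Q : proper_resolution (P_class C) M)
            (Q' : proper_resolution (P_class C) M')
            (G : proper_resolution (F_class C) M)
            (G' : proper_resolution (F_class C) M')
            (u : chain_map Q Q') (v : chain_map G G'),
        lifts f u -> lifts f v ->
        forall x : relTor Q N i,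
          phi M' N' Q' G' (relTor_map u g i x) =
          relTor_map v g i (phi M N Q G x)).
Proof.
move=> noethR semiC i.
have coevb := semidualizing_coev_bij noethR semiC.
have cmp M (Q : proper_resolution (P_class C) M)
    (G : proper_resolution (F_class C) M) :
    {u : chain_map Q G | forall x, aug G (u 0 x) = aug Q x}.
  apply: cid.
  apply: (comparison_exists (epsYK := augK (p := G)) (augK (p := Q)) _ idfun).
  move=> n.
  exact: proper_on_P_class.
exists (fun M N Q G =>
  homology_map (tens_chain_map (sval (cmp M Q G)) idfun) i).
split=> [M N Q G|M M' N N' f g Q Q' G G' u v uf vf x].
  exact: tens_comparison_bij (svalP (cmp M Q G)).
set c := sval (cmp M Q G); set c' := sval (cmp M' Q' G').
rewrite /relTor_map -!homology_map_comp.
have lift x0 : aug G' (c' 0 (u 0 x0)) = aug G' (v 0 (c 0 x0)).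
  by rewrite vf !(svalP (cmp _ _ _)) uf.
(* Both ways around the square are chain maps over f : M -> M'. *)
have hty : homotopic (comp_chain_map c' u) (comp_chain_map v c).
  exact: (comparison_homotopic (u := comp_chain_map c' u)
    (v := comp_chain_map v c) (@proper_on_P_class _ _ _ _ Q G') lift).
rewrite -[RHS](@eq_homology_map _ _ _ (tens_chain_map (comp_chain_map v c) g)).
  rewrite -(homotopic_homology _ (homotopic_tens g hty)).
  by apply: eq_homology_map => n z; apply: tens_map_compE.
by move=> n z; symmetry; apply: tens_map_compE.
Qed.
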